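(* Let $T$ be an operator (not necessarily linear) which is bounded on $L^p(\mathbb{R}^n)$ for every $1<p<\infty$. Let $\beta\in\mathbb{R}$ and suppose that for some $1<p_0<\infty$ there is a constant $c$, independent of $w$, such that for every $w\in A_{p_0}$ $$\|T\|_{L^{p_0}(w)}\le c\,[w]_{A_{p_0}}^{\beta}.$$ Then $$\beta\ge \max\left\{\gamma_T,\ \frac{\alpha_T}{p_0-1}\right\},$$ where $\alpha_T$ and $\gamma_T$ are the endpoint orders of $T$ at $p=1$ and $p=\infty$.
   Context: A weight is a non-negative locally integrable function $w$ on $\mathbb{R}^n$. For $1<p<\infty$, $p'$ is defined by $1/p+1/p'=1$, and $w\in A_p$ means $$[w]_{A_p}:=\sup_{Q}\left(\frac1{|Q|}\int_Q w\right)\left(\frac1{|Q|}\int_Q w^{1-p'}\right)^{p-1}<\infty,$$ the supremum being over all cubes $Q\subset\mathbb{R}^n$. $L^p(w)$ is the space with norm $\|f\|_{L^p(w)}=(\int|f|^p w\,dx)^{1/p}$, and $\|T\|_{L^p(w)}$ denotes the smallest constant $C$ such that $\|Tf\|_{L^p(w)}\le C\|f\|_{L^p(w)}$ for all $f\in L^p(w)$; $\|T\|_{L^p(\mathbb{R}^n)}$ is the case $w\equiv1$. For $T$ bounded on $L^p(\mathbb{R}^n)$ for all $1<p<\infty$, the endpoint orders are $$\alpha_T:=\sup\{\alpha\ge 0:\ \forall \varepsilon>0,\ \limsup_{p\to1^+}(p-1)^{\alpha-\varepsilon}\|T\|_{L^p(\mathbb{R}^n)}=\infty\},$$ $$\gamma_T:=\sup\left\{\gamma\ge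 0:\ \forall \varepsilon>0,\ \limsup_{p\to\infty}\frac{\|T\|_{L^p(\mathbb{R}^n)}}{p^{\gamma-\varepsilon}}=\infty\right\},$$ with suprema taken in the extended real line (so $\sup\emptyset=-\infty$). *)

(* Defs.v *)
From HB Require Import structures.
From mathcomp Require Import all_boot all_order all_algebra.
From mathcomp Require Import all_classical all_reals all_analysis.
From mathcomp Require Import complex.
Set Implicit Arguments.
Unset Strict Implicit.
Unset Printing Implicit Defensive.
Import Order.TTheory GRing.Theory Num.Theory.
Import numFieldNormedType.Exports.
Local Open Scope classical_set_scope.
Local Open Scope ring_scope.

(* The sigma-algebra on 'rV[R]_n generated by the coordinates, i.e. the
   product of n copies of the Borel sigma-algebra of R. *)
Definition measure_rV_display : measure_display -> measure_display.
Proof. exact. Qed.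

Section measurable_rV.
Context {R : realType} (n : nat).

Definition rV_coord (i : 'I_n) (x : 'rV[R]_n) : measurableTypeR R := x ord0 i.

Let rV_set0 : g_sigma_preimage rV_coord set0.
Proof. exact: sigma_algebra0. Qed.

Let rV_setC A : g_sigma_preimage rV_coord A ->
  g_sigma_preimage rV_coord (~` A).
Proof. exact: sigma_algebraC. Qed.

Let rV_bigcup (F : _^nat) : (forall i, g_sigma_preimage rV_coord (F i)) ->
  g_sigma_preimage rV_coord (\bigcup_i (F i)).
Proof. exact: sigma_algebra_bigcup. Qed.

HB.instance Definition _ := @isMeasurable.Build
  (measure_rV_display (measure_tuple_display default_measure_display))
  'rV[R]_n (g_sigma_preimage rV_coord)
  rV_set0 rV_setC rV_bigcup.

Lemma measurable_rV_coord i : measurable_fun setT (rV_coord i).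
Proof.
move=> _ Y mY; rewrite setTI; apply: sub_sigma_algebra => /=.
rewrite -bigcup_seq/=; exists i => /=; first by rewrite mem_index_enum.
by exists Y => //; rewrite setTI.
Qed.

Definition rV_of_tuple (t : n.-tuple (measurableTypeR R)) : 'rV[R]_n :=
  \row_i tnth t i.

Lemma measurable_rV_of_tuple : measurable_fun setT rV_of_tuple.
Proof.
have cE : (fun i => rV_coord i \o rV_of_tuple) = (fun i => @tnth n _ ^~ i).
  by apply/funext => i; apply/funext => t; rewrite /rV_coord /= mxE.
move=> _ A mA; rewrite setTI.
suff : g_sigma_preimage (fun i => rV_coord i \o rV_of_tuple)
    (rV_of_tuple @^-1` A) by rewrite cE.
by rewrite g_sigma_preimage_comp; exists A => //; rewrite setTI.
Qed.

End measurable_rV.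

Section lebesgue_measure_rV.
Context {R : realType}.
Local Notation RR := (measurableTypeR R).

Definition tuple_cons n (x : RR * n.-tuple RR) : n.+1.-tuple RR :=
  [the n.+1.-tuple RR of x.1 :: x.2].

Lemma measurable_tuple_cons n : measurable_fun setT (@tuple_cons n).
Proof. exact: measurable_cons. Qed.

Section step.
Variables (n : nat) (m : {sigma_finite_measure set (n.-tuple RR) -> \bar R}).

Definition lebesgue_tuple_step : set (n.+1.-tuple RR) -> \bar R :=
  pushforward (@lebesgue_measure R \x m)%E (@tuple_cons n).

Let pm : {measure set (n.+1.-tuple RR) -> \bar R} :=
  measure_function_pushforward__canonical__measure_function_Measure
    (@lebesgue_measure R \x m)%E (@measurable_tuple_cons n).

HB.instance Definition _ := isMeasure.Build _ _ _ lebesgue_tuple_step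
  (measure0 pm) (measure_ge0 pm) (@measure_semi_sigma_additive _ _ _ pm).

Let sigma_finite_step : sigma_finite setT lebesgue_tuple_step.
Proof.
have /sigma_finiteP[F [FT ndF mF]] := sigma_finiteT (@lebesgue_measure R).
have /sigma_finiteP[G [GT ndG mG]] := sigma_finiteT m.
pose g (t : n.+1.-tuple RR) : RR * n.-tuple RR := (thead t, [tuple of behead t]).
have mg : measurable_fun setT g.
  apply/measurable_fun_pairP; split.
    exact: (measurable_tnth ord0).
  exact: measurable_behead.
have gK : cancel (@tuple_cons n) g.
  move=> [x t]; rewrite /g /tuple_cons /=; congr pair.
  by apply/val_inj.
exists (fun k => g @^-1` (F k `*` G k)).
  rewrite -preimage_bigcup (_ : \bigcup_k _ = setT) ?preimage_setT //.
  apply/seteqP; split => // -[x t] _.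
  have [i _ Fi] : (\bigcup_k F k) x by rewrite -FT.
  have [j _ Gj] : (\bigcup_k G k) t by rewrite -GT.
  exists (maxn i j) => //; split => /=.
    by move: x Fi; exact/subsetPset/ndF/leq_maxl.
  by move: t Gj; exact/subsetPset/ndG/leq_maxr.
move=> k; have [mFk Fk] := mF k; have [mGk Gk] := mG k.
split; first by rewrite -[X in measurable X]setTI; apply: mg => //; exact: measurableX.
rewrite /lebesgue_tuple_step /pushforward -comp_preimage.
rewrite (_ : g \o _ = id); last by apply/funext => x; rewrite /= gK.
by rewrite preimage_id product_measure1E// lte_mul_pinfty// ge0_fin_numE.
Qed.

HB.instance Definition _ :=
  Measure_isSigmaFinite.Build _ _ _ lebesgue_tuple_step sigma_finite_step.

End step.

Fixpoint lebesgue_tuple n : {sigma_finite_measure set (n.-tuple RR) -> \bar R} :=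
  match n with
  | 0 => \d_ ([tuple] : 0.-tuple RR)
  | k.+1 => lebesgue_tuple_step (lebesgue_tuple k)
  end.

(* Lebesgue measure on R^n (on Borel sets): the n-fold product of
   [lebesgue_measure]. *)
Definition lebesgue_rV n : set 'rV[R]_n -> \bar R :=
  pushforward (lebesgue_tuple n) (@rV_of_tuple R n).

Section lebesgue_rV_measure.
Variable n : nat.

Let pm : {measure set 'rV[R]_n -> \bar R} :=
  measure_function_pushforward__canonical__measure_function_Measure
    (lebesgue_tuple n) (@measurable_rV_of_tuple R n).

HB.instance Definition _ := isMeasure.Build _ _ _ (@lebesgue_rV n)
  (measure0 pm) (measure_ge0 pm) (@measure_semi_sigma_additive _ _ _ pm).

Let sigma_finite_lebesgue_rV : sigma_finite setT (@lebesgue_rV n).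
Proof.
have [F FT mF] := sigma_finiteT (lebesgue_tuple n).
pose g (x : 'rV[R]_n) : n.-tuple RR := [tuple x ord0 i | i < n].
have mg : measurable_fun setT g.
  apply/measurable_fun_tnthP => i.
  rewrite (_ : _ \o _ = rV_coord i); last first.
    by apply/funext => x; rewrite /= tnth_mktuple.
  exact: measurable_rV_coord.
have gK : cancel (@rV_of_tuple R n) g.
  by move=> t; apply/eq_from_tnth => i; rewrite tnth_mktuple mxE.
exists (fun k => g @^-1` F k).
  by rewrite -preimage_bigcup -FT preimage_setT.
move=> k; have [mFk Fk] := mF k; split.
  by rewrite -[X in measurable X]setTI; exact: mg.
rewrite /lebesgue_rV /pushforward -comp_preimage.
by rewrite (_ : g \o _ = id) //; apply/funext => x; rewrite /= gK.
Qed.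

HB.instance Definition _ :=
  Measure_isSigmaFinite.Build _ _ _ (@lebesgue_rV n) sigma_finite_lebesgue_rV.

End lebesgue_rV_measure.

End lebesgue_measure_rV.

Section lebesgue_rV_box.
Context {R : realType}.
Local Notation RR := (measurableTypeR R).

Lemma lebesgue_tuple_box n (A : 'I_n -> set RR) :
  (forall i, measurable (A i)) ->
  lebesgue_tuple n [set t : n.-tuple RR | forall i, A i (tnth t i)] =
  (\prod_(i < n) @lebesgue_measure R (A i))%E.
Proof.
elim: n A => [|n IH] A mA.
  rewrite big_ord0 /= diracE mem_set //= => -[].
  by [].
rewrite big_ord_recl /= /lebesgue_tuple_step /pushforward.
rewrite (_ : _ @^-1` _ = A ord0 `*`
    [set t : n.-tuple RR | forall i, A (lift ord0 i) (tnth t i)]).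
  rewrite product_measure1E//; last first.
    rewrite (_ : [set _ | _] = \bigcap_(i in [set: 'I_n])
        ((fun t => tnth t i) @^-1` A (lift ord0 i))); last first.
      by apply/seteqP; split => t /= h i; [move=> _|]; apply: h.
    apply: fin_bigcap_measurable => // i _.
    rewrite -[X in measurable X]setTI.
    by apply: (@measurable_tnth _ RR n i) => //; exact: mA.
  by congr (_ * _)%E; exact: (IH (fun i => A (lift ord0 i))).
apply/seteqP; split => -[x t] /=.
  move=> h; split; first by have := h ord0.
  by move=> i; have := h (lift ord0 i); rewrite tnthS.
move=> [h0 h] i; case: (unliftP ord0 i) => [j ->|->] //.
by rewrite tnthS; exact: h.
Qed.

Lemma lebesgue_rV_box n (A : 'I_n -> set RR) :
  (forall i, measurable (A i)) ->
  lebesgue_rV [set x : 'rV[R]_n | forall i, A i (x ord0 i)] =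
  (\prod_(i < n) @lebesgue_measure R (A i))%E.
Proof.
move=> mA; rewrite -lebesgue_tuple_box // /lebesgue_rV /pushforward.
by congr (lebesgue_tuple n _); apply/seteqP; split => t /= h i; have := h i;
  rewrite mxE.
Qed.

End lebesgue_rV_box.

Section weights.
Context {R : realType} {n : nat}.
Local Notation En := 'rV[R]_n.
Local Notation leb := (@lebesgue_rV R n).
Local Open Scope ereal_scope.

(* The closed cube with lower corner a and side length l. *)
Definition cube (a : En) (l : R) : set En :=
  [set x | forall i, (a ord0 i <= x ord0 i <= a ord0 i + l)%R].

Definition average (Q : set En) (f : En -> \bar R) : \bar R :=
  (leb Q)^-1 * \int[leb]_(x in Q) f x.

Definition is_weight (w : En -> R) : Prop :=
  [/\ measurable_fun setT (w : En -> measurableTypeR R),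
      forall x, (0 <= w x)%R &
      forall K : set En, compact K -> \int[leb]_(x in K) (w x)%:E < +oo].

Definition conj_exponent (p : R) : R := ((1 - p^-1)^-1)%R.

Lemma conj_exponentE (p : R) : (p^-1 + (conj_exponent p)^-1 = 1)%R.
Proof. by rewrite /conj_exponent invrK addrC subrK. Qed.

(* w^{1-p'} for p > 1, with value +oo where w = 0: powR would give 0 there,
   although the exponent is negative. *)
Definition dual_weight (p : R) (w : En -> R) (x : En) : \bar R :=
  if w x == 0%R then +oo else (w x `^ (1 - conj_exponent p))%:E.

Definition Ap_const (p : R) (w : En -> R) : \bar R :=
  ereal_sup [set average (cube Q.1 Q.2) (EFin \o w) *
                 average (cube Q.1 Q.2) (dual_weight p w) `^ (p - 1)
            | Q in [set Q : En * R | (0 < Q.2)%R]].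

Definition Ap (p : R) (w : En -> R) : Prop := is_weight w /\ Ap_const p w < +oo.

Definition measurable_complex (f : En -> R[i]) : Prop :=
  measurable_fun setT (fun x => complex.Re (f x) : measurableTypeR R) /\
  measurable_fun setT (fun x => complex.Im (f x) : measurableTypeR R).

Definition Lp_norm (p : R) (w : En -> R) (f : En -> R[i]) : \bar R :=
  (\int[leb]_x (Normc.normc (f x) `^ p * w x)%:E) `^ p^-1.

Definition in_Lp (p : R) (w : En -> R) (f : En -> R[i]) : Prop :=
  measurable_complex f /\ Lp_norm p w f < +oo.

(* ||T||_{L^p(w)}; it is +oo when no constant works.  Only the values of T on
   L^p(w) matter, so an operator with a smaller domain can be extended
   arbitrarily, e.g. by 0. *)
Definition op_norm (T : (En -> R[i]) -> (En -> R[i])) (p : R) (w : En -> R)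
    : \bar R :=
  ereal_inf [set C%:E | C in [set C : R | (0 <= C)%R /\
    forall f, in_Lp p w f ->
      in_Lp p w (T f) /\ Lp_norm p w (T f) <= C%:E * Lp_norm p w f]].

Definition unweighted_norm T (p : R) : \bar R := op_norm T p (cst 1%R).

Definition endpoint_order_1 T : \bar R :=
  ereal_sup [set a%:E | a in [set a : R | (0 <= a)%R /\
    forall e : R, (0 < e)%R ->
      limf_esup (fun p : R => ((p - 1) `^ (a - e))%:E * unweighted_norm T p)
        (1%R : R)^'+ = +oo]].

Definition endpoint_order_oo T : \bar R :=
  ereal_sup [set g%:E | g in [set g : R | (0 <= g)%R /\
    forall e : R, (0 < e)%R ->
      limf_esup (fun p : R => unweighted_norm T p * ((p `^ (g - e))^-1)%:E)
        +oo%R = +oo]].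

End weights.

(* Main.v *)
(** Every exponent that works in the weighted bound forces a growth rate of the
unweighted norms through a quantitative Rubio de Francia argument.  Given
[h >= 0] in [L^q], [1 < q <= 2], the series [W] of the [(4K)^-k M^k h], with
[K ~ 1/(q-1)] the strong type constant of the maximal function [M], majorizes
[h], has comparable [L^q] norm, and satisfies [M W <= 4K W].

For [p > p0], take [h = |Tf|^(p-p0)] and [q = (p/p0)'], so that [K ~ p]: the
weight [W] has [A_p0] constant [O(p)], whence [||T||_p = O(p^beta)].  For
[p < p0], take [h = |f|] and [q = p]: the weight [W^(p-p0)] has [A_p0] constant
[O((p-1)^(p-p0))], whence [||T||_p = O((p-1)^(-beta (p0-p)))].

If [beta < 0], adding to a weight a bump of height [N] on a cube where [f] has
little mass makes its [A_p0] constant tend to infinity with [N] while hardly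
changing the norm of [f], so that [Tf] vanishes; by extrapolation [||T||_p = 0]
for [p] near the endpoints, and both endpoint orders are [-oo]. *)
Require Import Defs.
From mathcomp Require Import all_boot all_order all_algebra.
From mathcomp Require Import all_classical all_reals all_analysis.
From mathcomp Require Import measurable_realfun complex.
From mathcomp Require Import ring lra.
Set Implicit Arguments.
Unset Strict Implicit.
Unset Printing Implicit Defensive.
Import Order.TTheory GRing.Theory Num.Theory.
Import numFieldNormedType.Exports.
Local Open Scope classical_set_scope.
Local Open Scope ring_scope.
Local Open Scope ereal_scope.

(** Both endpoint powers come from the rate [O(1/(q-1))] of the maximal function on L^q as q tends
    to 1, so that rate is proved with explicit constants. It is linear because the weak type bound
    at level l integrates g only over the set where g > l/2, which leaves a geometric sum of
    (q-1)-th powers. The requirement q <= 2 is what puts the thresholds p <= 2 below p0 and p >= 2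
    p0 above it.

    T need not be linear, so there is no passage to an adjoint: above p0 the weight is built from Tf
    itself. Boundedness of T on L^p then puts [h] in L^q and allows cancelling the power of the norm
    of Tf that reappears on the right.

    The construction controls A_p0 constants from above only, which bounds their beta-th power only
    when beta >= 0. For beta < 0 one needs weights with large constants, hence the bumps.

    The maximal function runs over a countable family of cubes, which makes it measurable as the
    supremum of a sequence; every cube lies in a member of at most twice its side, at the cost of a
    factor 2^n in averages. *)

(** * Powers and Hölder's inequality *)

Lemma ge0_le_poweR (R : realType) (x y : \bar R) (r : R) :
  (0 <= r)%R -> 0 <= x -> x <= y -> x `^ r <= y `^ r.
Proof.
move=> r0 x0 xy; apply: gt0_ler_poweR => //; rewrite in_itv/= leey andbT//.
exact: le_trans x0 xy.
Qed.

Lemma measurable_powRl (R : realType) d (T : measurableType d) (D : set T)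
    (f : T -> R) (r : R) : measurable_fun D f ->
  measurable_fun D (fun x => (f x `^ r)%R).
Proof. exact: (@measurableT_comp _ _ _ _ _ _ (@powR R ^~ r)). Qed.

(** Hölder's inequality for the exponents [1 / t] and [1 / (1 - t)]. In this form it interpolates
    between two integrals without roots; the extrapolations take [t = p / p0] or [t = p0 / p]. *)
Lemma hoelder_powR d (T : measurableType d) (R : realType)
    (mu : {measure set T -> \bar R}) (D : set T) (F G : T -> R) (t : R) :
  measurable D -> measurable_fun D F -> measurable_fun D G ->
  (forall x, D x -> (0 <= F x)%R) -> (forall x, D x -> (0 <= G x)%R) ->
  (0 < t)%R -> (t < 1)%R ->
  \int[mu]_(x in D) (F x `^ t * G x `^ (1 - t))%:E <=
  (\int[mu]_(x in D) (F x)%:E) `^ t * (\int[mu]_(x in D) (G x)%:E) `^ (1 - t).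
Proof.
move=> mD mF mG F0 G0 t0 t1.
have s0 : (0 < 1 - t)%R by rewrite subr_gt0.
pose f := (fun x => F x `^ t)%R \_ D; pose g := (fun x => G x `^ (1 - t))%R \_ D.
have mf : measurable_fun setT f.
  by apply/(measurable_restrictT _ mD); exact: measurable_powRl.
have mg : measurable_fun setT g.
  by apply/(measurable_restrictT _ mD); exact: measurable_powRl.
have := @hoelder _ _ _ mu f g t^-1 (1 - t)^-1 mf mg.
rewrite !invr_gt0 !invrK => /(_ t0 s0) /(_ _)/wrap[|]; first by rewrite addrC subrK.
rewrite Lnorm1 unlock /= !invrK.
have patchE (h : T -> R) r : (0 < r)%R -> (forall x, D x -> (0 <= h x)%R) ->
    \int[mu]_x (`|((fun x => h x `^ r)%R \_ D) x|%:E `^ r^-1) =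
    \int[mu]_(x in D) (h x)%:E.
  move=> r0 h0; rewrite [RHS]integral_mkcond; apply: eq_integral => x _.
  rewrite /patch; case: ifPn => [xD|_].
    rewrite ger0_norm ?powR_ge0// poweR_EFin -powRrM divff ?gt_eqF// powRr1//.
    by apply: h0; rewrite inE in xD.
  by rewrite normr0 poweR0r// gt_eqF// invr_gt0.
rewrite [X in _ <= X `^ _ * _](patchE _ _ t0 F0).
rewrite [X in _ <= _ * X `^ _](patchE _ _ s0 G0); apply: le_trans.
rewrite integral_mkcond le_eqVlt; apply/orP; left; apply/eqP.
apply: eq_integral => x _; rewrite /f /g /patch; case: ifPn => // _.
  by rewrite ger0_norm// mulr_ge0// powR_ge0.
by rewrite mulr0 normr0.
Qed.

(** * Cubes *)

Section cubes.
Context {R : realType} {n : nat}.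
Local Notation En := 'rV[R]_n.
Local Notation leb := (@lebesgue_rV R n).
Implicit Types (a x : En) (l r : R).

Lemma cubeE a l : cube a l =
  [set x : En | forall i, `[a ord0 i, (a ord0 i + l)%R]%classic (x ord0 i)].
Proof. by apply/seteqP; split => x /= h i; have := h i; rewrite in_itv. Qed.

Lemma measurable_cube a l : measurable (cube a l).
Proof.
rewrite cubeE (_ : [set _ | _] = \bigcap_(i in [set: 'I_n])
    ((@rV_coord R n i) @^-1` `[a ord0 i, (a ord0 i + l)%R]%classic)); last first.
  by apply/seteqP; split => x /= h i; [move=> _|]; apply: h.
apply: fin_bigcap_measurable => // i _.
rewrite -[X in measurable X]setTI.
by apply: measurable_rV_coord => //; exact: measurable_itv.
Qed.
Hint Resolve measurable_cube : core.

Lemma lebesgue_cube a l : (0 <= l)%R -> leb (cube a l) = (l ^+ n)%:E.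
Proof.
move=> l0.
rewrite cubeE (@lebesgue_rV_box R n (fun i => `[a ord0 i, (a ord0 i + l)%R]%classic));
  last by move=> i; exact: measurable_itv.
under eq_bigr do rewrite lebesgue_measure_itv/= lte_fin.
rewrite (eq_bigr (fun=> l%:E)); last first.
  move=> i _; rewrite ltrDl; case: ltP => [_|l0'].
    by rewrite -EFinB addrC addKr.
  by congr EFin; apply/le_anti; rewrite l0 l0'.
rewrite -(big_morph EFin (@EFinM R) erefl).
by rewrite big_const_ord iter_mulr_1.
Qed.

Lemma cube_subset a (b : En) l r :
  (forall i, b ord0 i <= a ord0 i)%R ->
  (forall i, a ord0 i + l <= b ord0 i + r)%R -> cube a l `<=` cube b r.
Proof.
move=> ba lr x xa i; have /andP[h1 h2] := xa i.
by rewrite (le_trans (ba i) h1) (le_trans h2 (lr i)).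
Qed.

(** Codes that decode to nothing or to a non-positive side are sent to side 1, so that every index
    gives a cube of positive measure. *)
Definition rat_cube (k : nat) : En * R :=
  if @unpickle ('rV[rat]_n * rat)%type k is Some (c, r) then
    (map_mx ratr c, if (0 < r)%R then ratr r else 1%R)
  else (0%R, 1%R).

Definition qside k := (rat_cube k).2.
Definition qcube k := cube (rat_cube k).1 (qside k).

Lemma qside_gt0 k : (0 < qside k)%R.
Proof.
rewrite /qside /rat_cube; case: unpickle => [[c r]|]//=.
by case: ifPn => // r0; rewrite ltr0q.
Qed.

Lemma measurable_qcube k : measurable (qcube k).
Proof. exact: measurable_cube. Qed.

Lemma lebesgue_qcube k : leb (qcube k) = (qside k ^+ n)%:E.
Proof. by rewrite lebesgue_cube// ltW// qside_gt0. Qed.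

(** Moving each corner coordinate down by less than [l / 4] and taking a side above [l + l / 4]
    still covers the cube. *)
Lemma cube_sub_qcube a l : (0 < l)%R ->
  exists k, cube a l `<=` qcube k /\ (qside k <= 2 * l)%R.
Proof.
move=> l0.
have /choice[c cP] : forall i : 'I_n, exists q : rat,
    (a ord0 i - l / 4 < ratr q < a ord0 i)%R.
  move=> i; have [q] : exists q, ratr q \in `](a ord0 i - l / 4)%R, (a ord0 i)[.
    by apply: rat_in_itvoo; lra.
  by rewrite in_itv/= => ?; exists q.
have [r] : exists q, ratr q \in `](l + l / 4)%R, (2 * l)%R[.
  by apply: rat_in_itvoo; lra.
rewrite in_itv/= => /andP[r1 r2].
have r0 : (0 < r)%R by rewrite -(ltr0q R); lra.
exists (pickle (\row_i c i, r)); rewrite /qcube /qside /rat_cube pickleK r0/=.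
split; last exact: ltW.
by apply: cube_subset => i; rewrite !mxE; have /andP[] := cP i; lra.
Qed.

Definition big_cube (N : nat) : set En := cube (const_mx (- N%:R)%R) (2 * N%:R)%R.

Lemma big_cubeP N x : big_cube N x <-> forall i, (`|x ord0 i| <= N%:R)%R.
Proof.
by split => h i; have := h i; rewrite mxE ler_norml => /andP[? ?]; apply/andP; lra.
Qed.

Lemma big_cube_ndecr : nondecreasing_seq big_cube.
Proof.
move=> N M NM; apply/subsetPset => x /big_cubeP h; apply/big_cubeP => i.
by rewrite (le_trans (h i))// ler_nat.
Qed.

Lemma big_cube_absorb x : exists N, forall M, (N <= M)%N -> big_cube M x.
Proof.
exists (\max_(i < n) (Num.truncn `|x ord0 i|).+1) => M NM; apply/big_cubeP => i.
rewrite (le_trans (ltW (truncnS_gt _)))// ler_nat (leq_trans _ NM)//.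
exact: (leq_bigmax i).
Qed.

Lemma bigcup_big_cube : \bigcup_N big_cube N = setT.
Proof.
apply/seteqP; split => // x _; have [N h] := big_cube_absorb x.
by exists N => //; apply: h.
Qed.

Lemma compact_cube a l : compact (cube a l).
Proof.
rewrite cubeE.
apply: (@rV_compact _ _ (fun i => `[a ord0 i, (a ord0 i + l)%R]%classic)) => i.
exact: segment_compact.
Qed.

(** The index is a successor because [big_cube 0] has side 0, and averages need a positive side. *)
Lemma compact_sub_big_cube (K : set En) : compact K -> exists N, K `<=` big_cube N.+1.
Proof.
move=> cK.
have /choice[M MP] : forall i : 'I_n, exists M : nat, forall x, K x ->
    (`|x ord0 i| <= M%:R)%R.
  move=> i.
  have cKi : compact ((fun x : En => x ord0 i) @` K).
    apply: continuous_compact => //; apply: continuous_subspaceT.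
    exact: coord_continuous.
  have [M [_ MP]] := compact_bounded cKi.
  exists (Num.truncn (M + 1)%R).+1 => x Kx.
  rewrite (le_trans _ (ltW (truncnS_gt _)))//.
  by apply: (MP (M + 1)%R); [rewrite ltrDl|exists x].
exists (\max_(i < n) M i) => x Kx; apply/big_cubeP => i.
rewrite (le_trans (MP i x Kx))// ler_nat leqW//.
exact: (leq_bigmax i).
Qed.

End cubes.
#[global] Hint Extern 0 (measurable (cube _ _)) => solve [apply: measurable_cube] : core.
#[global] Hint Extern 0 (measurable (qcube _)) => solve [apply: measurable_qcube] : core.
Arguments qside {R} n k.

(** * The maximal function *)

Section maximal_function.
Context {R : realType} {n : nat}.
Local Notation En := 'rV[R]_n.
Local Notation leb := (@lebesgue_rV R n).
Implicit Types (g phi : En -> \bar R) (k : nat).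

(** The uncentred Hardy-Littlewood maximal function along the cubes [qcube k]. A cube that misses
    [x] contributes 0, which is harmless for [g >= 0]. *)
Definition maximal g (x : En) : \bar R :=
  ereal_sup [set (cst (average (qcube k) g) \_ (qcube k)) x | k in [set: nat]].

Lemma averageE (a : En) l g : (0 < l)%R ->
  average (cube a l) g = ((l ^+ n)^-1)%:E * \int[leb]_(x in cube a l) g x.
Proof.
move=> l0; rewrite /average lebesgue_cube ?(ltW l0)// inver ifF//.
by rewrite gt_eqF// exprn_gt0.
Qed.

Lemma average_ge0 (Q : set En) g : (forall x, 0 <= g x) -> 0 <= average Q g.
Proof. by move=> g0; rewrite mule_ge0// ?inve_ge0// integral_ge0. Qed.

Lemma average_le_maximal g k x : qcube k x -> average (qcube k) g <= maximal g x.
Proof.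
by move=> kx; apply: ereal_sup_ubound; exists k => //; rewrite patchE mem_set.
Qed.

Lemma maximal_ge0 g x : (forall x, 0 <= g x) -> 0 <= maximal g x.
Proof.
move=> g0; apply: le_trans (ereal_sup_ubound _); last by exists 0%N.
by apply: erestrict_ge0 => *; exact: average_ge0.
Qed.

Lemma measurable_maximal g : measurable_fun setT (maximal g).
Proof.
have -> : maximal g =
    fun x => esups (fun k => (cst (average (qcube k) g) \_ (qcube k)) x) 0%N.
  by apply/funext => x; congr (ereal_sup [set _ | _ in _]); apply/seteqP; split.
apply: measurable_fun_esups => k.
by apply/(measurable_restrictT _ (measurable_qcube k)).
Qed.

Lemma maximal_gt g (l : R) : (0 <= l)%R ->
  [set x | l%:E < maximal g x] =
  \bigcup_(k in [set k | l%:E < average (qcube k) g]) qcube k.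
Proof.
move=> l0; apply/seteqP; split => [x /= /ereal_sup_gt[_ [k _ <-]]|x [k /= lk kx]].
  rewrite patchE; case: ifPn => [/[!inE] kx lk|_]; first by exists k.
  by rewrite lte_fin ltNge l0.
by rewrite (lt_le_trans lk)// average_le_maximal.
Qed.

(** [A] is the concentric cube of triple side: a cube no larger than [qcube k] that meets it cannot
    reach further than one side length beyond it. *)
Lemma qcube_triple k : exists A : set En, [/\ measurable A,
  leb A = (3 ^+ n)%:E * leb (qcube k), qcube k `<=` A &
  forall j, (qside n j <= qside n k :> R)%R -> @qcube R n j `&` qcube k !=set0 -> qcube j `<=` A].
Proof.
have k0 := @qside_gt0 R n k.
set c := (@rat_cube R n k).1.
exists (cube (c - const_mx (qside n k)) (3 * qside n k)%R); split.
- exact: measurable_cube.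
- by rewrite lebesgue_cube ?lebesgue_qcube ?exprMn// mulr_ge0// ltW.
- by apply: cube_subset => i; rewrite !mxE; lra.
- move=> j jk [y [jy ky]] x jx i.
  have /andP[] := jy i; have /andP[] := ky i; have /andP[] := jx i.
  by rewrite -/c !mxE => *; apply/andP; lra.
Qed.

Lemma qcube_corner k : qcube k ((@rat_cube R n k).1).
Proof. by move=> i; rewrite lexx lerDl ltW// qside_gt0. Qed.

Lemma exists_largest (s : seq nat) (f : nat -> R) : s != [::] ->
  exists2 k, k \in s & forall j, j \in s -> (f j <= f k)%R.
Proof.
elim: s => // i s IH _; have [->|/IH[k ks km]] := eqVneq s [::].
  by exists i; rewrite ?mem_head// => j; rewrite inE => /eqP ->.
have [ik|ki] := leP (f i) (f k).
  exists k; first by rewrite inE ks orbT.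
  by move=> j; rewrite inE => /predU1P[->//|/km].
exists i; first by rewrite mem_head.
move=> j; rewrite inE => /predU1P[->//|/km jk].
by rewrite (le_trans jk)// ltW.
Qed.

(* The largest cube is kept, the cubes meeting it lie in its triple, and the
   remaining ones are disjoint from it. *)
Lemma vitali_cover_seq phi (s : seq nat) :
  measurable_fun setT phi -> (forall x, 0 <= phi x) ->
  (forall k, k \in s -> leb (qcube k) <= \int[leb]_(x in qcube k) phi x) ->
  leb (\big[setU/set0]_(k <- s) qcube k) <=
  (3 ^+ n)%:E * \int[leb]_(x in \big[setU/set0]_(k <- s) qcube k) phi x.
Proof.
move=> mphi phi0.
have mU (t : seq nat) : measurable (\big[setU/set0]_(k <- t) @qcube R n k).
  apply: bigsetU_measurable => k _; exact: measurable_qcube.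
have phiS (A : set En) : measurable_fun A phi.
  exact: measurable_funS measurableT (@subsetT _ _) mphi.
have inU (t : seq nat) x : (\big[setU/set0]_(k <- t) @qcube R n k) x <->
    exists2 k, k \in t & qcube k x.
  by rewrite -bigcup_seq; split => -[k ? ?]; exists k.
have [m] := ubnP (size s); elim: m s => // m IH s sm sP.
have [->|s0] := eqVneq s [::].
  by rewrite !big_nil measure0 integral_set0 mule0.
have [k ks kmax] := exists_largest (qside n) s0.
have [A [mA A3 kA jA]] := qcube_triple k.
pose s' := [seq j <- s | `[< qcube j `&` qcube k = set0 :> set En >]].
have s's : (size s' < m)%N.
  rewrite -ltnS (leq_trans _ sm)// ltnS size_filter ltn_neqAle count_size.
  rewrite andbT -all_count; apply/negP => /allP/(_ k ks)/asboolP.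
  by rewrite setIid; apply/eqP/set0P; exists (rat_cube k).1; exact: qcube_corner.
have s'P j : j \in s' -> j \in s /\ qcube j `&` qcube k = set0 :> set En.
  by rewrite mem_filter => /andP[/asboolP].
have sub : \big[setU/set0]_(j <- s) @qcube R n j `<=`
    A `|` \big[setU/set0]_(j <- s') @qcube R n j.
  move=> x /inU[j js jx].
  have [/asboolP jk|/asboolPn/eqP/set0P jk] :=
      boolP (`[< qcube j `&` qcube k = set0 :> set En >]).
    by right; apply/inU; exists j => //; rewrite mem_filter js andbT; apply/asboolP.
  by left; apply: (jA j) => //; exact: kmax.
have mAU : measurable (A `|` \big[setU/set0]_(j <- s') @qcube R n j).
  by apply: measurableU; [exact: mA|exact: mU].
have := le_measure leb (mem_set (mU s)) (mem_set mAU) sub.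
move=> /le_trans; apply.
apply: (le_trans (measureU2 leb mA (mU s'))).
apply: (@le_trans _ _ ((3 ^+ n)%:E * \int[leb]_(x in qcube k) phi x +
    (3 ^+ n)%:E * \int[leb]_(x in \big[setU/set0]_(j <- s') qcube j) phi x)).
  apply: leeD.
    apply: (@le_trans _ _ ((3 ^+ n)%:E * leb (qcube k))); first by rewrite -A3.
    by rewrite lee_wpmul2l ?lee_fin ?exprn_ge0//; exact: sP.
  by apply: IH => // j /s'P[/sP].
rewrite -ge0_muleDr ?integral_ge0// lee_wpmul2l ?lee_fin ?exprn_ge0//.
rewrite -ge0_integral_setU//.
- apply: ge0_subset_integral => //.
    by apply: measurableU; [exact: measurable_qcube|exact: mU].
  move=> x [kx|/inU[j /s'P[js _] jx]]; apply/inU; by [exists k|exists j].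
- apply/disj_set2P/seteqP; split => // x [kx /inU[j /s'P[_ jk] jx]].
  by have : (qcube j `&` qcube k) x by []; rewrite jk.
Qed.

(** The finite bound does not depend on the number of cubes, so it passes to the union of an
    increasing sequence of finite subfamilies. *)
Lemma vitali_cover phi (P : set nat) :
  measurable_fun setT phi -> (forall x, 0 <= phi x) ->
  (forall k, P k -> leb (qcube k) <= \int[leb]_(x in qcube k) phi x) ->
  leb (\bigcup_(k in P) qcube k) <= (3 ^+ n)%:E * \int[leb]_x phi x.
Proof.
move=> mphi phi0 HP.
pose s N := [seq k <- iota 0 N | `[< P k >]].
pose F N := \big[setU/set0]_(k <- s N) @qcube R n k.
have FE N : F N = \bigcup_(k in [set k | P k /\ (k < N)%N]) qcube k.
  rewrite /F -bigcup_seq; apply/seteqP; split => x [k /= + kx].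
    by rewrite mem_filter mem_iota => /andP[/asboolP ? /andP[]]; exists k.
  move=> [? ?]; exists k => //=; rewrite mem_filter mem_iota/= add0n.
  by apply/andP; split => //; apply/asboolP.
have FU : \bigcup_N F N = \bigcup_(k in P) qcube k.
  apply/seteqP; split => [x [N _]|x [k Pk kx]].
    by rewrite FE => -[k [Pk _] kx]; exists k.
  by exists k.+1 => //; rewrite FE; exists k.
have mF N : measurable (F N) by apply: bigsetU_measurable => k _; exact: measurable_qcube.
have ndF : nondecreasing_seq F.
  move=> N M NM; apply/subsetPset => x; rewrite !FE => -[k [Pk kN] kx].
  by exists k => //; split => //; exact: leq_trans NM.
rewrite -FU; have := nondecreasing_cvg_mu (mu := leb) mF (bigcup_measurable (fun N _ => mF N)) ndF.
apply: cvge_le; apply: nearW => N.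
apply: (le_trans (vitali_cover_seq mphi phi0 _)).
  by move=> k; rewrite mem_filter => /andP[/asboolP /HP].
rewrite lee_wpmul2l ?lee_fin ?exprn_ge0//.
by apply: ge0_subset_integral => //; exact: mF.
Qed.

(** On a cube where the average of [g] exceeds [l], the values of [g] up to [l / 2] account for at
    most half of it, so the measure of the cube is at most [2 / l] times the integral of [g] over
    its points with [g > l / 2]. The covering lemma is applied to that truncated density [phi]. *)
Lemma maximal_weak_type g (l : R) :
  measurable_fun setT g -> (forall x, 0 <= g x) -> (0 < l)%R ->
  leb [set x | l%:E < maximal g x] <=
  (3 ^+ n * (2 / l))%:E * \int[leb]_(x in [set x | (l / 2)%:E < g x]) g x.
Proof.
move=> mg g0 l0; rewrite maximal_gt ?(ltW l0)//.
have l2 : (0 < 2 / l)%R by rewrite divr_gt0.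
set E := [set x | (l / 2)%:E < g x].
have mE : measurable E by rewrite -[E]setTI; exact: emeasurable_fun_o_infty.
pose phi x := (2 / l)%:E * (g \_ E) x.
have gE0 x : 0 <= (g \_ E) x by apply: erestrict_ge0 => *; exact: g0.
have mgE : measurable_fun setT (g \_ E).
  by apply/(measurable_restrictT _ mE); exact: measurable_funS mg.
have mphi : measurable_fun setT phi by exact: measurable_funeM.
apply: (le_trans (vitali_cover mphi _ _)).
- by move=> x; rewrite mule_ge0// lee_fin ltW.
- move=> k /=; have k0 : (0 < qside n k ^+ n :> R)%R by rewrite exprn_gt0// qside_gt0.
  rewrite averageE ?qside_gt0// lte_pdivlMl//.
  rewrite ge0_integralZl//; last 2 first.
    exact: measurable_funS mgE.
    by rewrite lee_fin ltW.
  move=> lk; rewrite -lee_pdivrMl// invf_div.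
  have : \int[leb]_(x in qcube k) g x <=
      \int[leb]_(x in qcube k) (g \_ E) x + (l / 2)%:E * leb (qcube k).
    rewrite -[X in _ + X]integral_cst// -ge0_integralD//; last 2 first.
      exact: measurable_funS mgE.
      by move=> x _; rewrite lee_fin divr_ge0// ltW.
    apply: ge0_le_integral => //.
    - exact: measurable_funS mg.
    - by apply: emeasurable_funD => //; exact: measurable_funS mgE.
    move=> x _ /=; rewrite patchE; case: ifPn => [_|].
      by rewrite leeDl// lee_fin divr_ge0// ltW.
    by rewrite notin_setE /E/= add0e => /negP; rewrite -leNgt.
  move=> /(lt_le_trans lk); rewrite -lteBlDr ?lebesgue_qcube//.
  rewrite -!EFinM -EFinB => /ltW; apply: le_trans; rewrite lee_fin.
  by rewrite mulrC le_eqVlt; apply/orP; left; apply/eqP; field.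
rewrite /phi ge0_integralZl//; last by rewrite lee_fin ltW.
by rewrite (integral_mkcond E) muleA -EFinM.
Qed.
End maximal_function.

(** * Sums over dyadic levels *)

Section dyadic_levels.
Context {R : realType}.
Implicit Types (y t s p : R) (N j J : nat).

(** The level 2^(j - N). Natural indices replace the integer powers of 2: levels are cut off at
    2^-N, and [N] tends to infinity in [maximal_strong_type]. *)
Definition dbl N j : R := (2 ^+ j / 2 ^+ N)%R.

Lemma dbl_gt0 N j : (0 < dbl N j)%R.
Proof. by rewrite divr_gt0// exprn_gt0. Qed.

Lemma dblS N j : dbl N j.+1 = (2 * dbl N j)%R.
Proof. by rewrite /dbl exprS mulrA. Qed.

Lemma dyadic_above N y : (dbl N 0 < y)%R ->
  exists j, (dbl N j < y)%R /\ (y <= 2 * dbl N j)%R.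
Proof.
move=> y0.
have ex : exists j, (y <= dbl N j.+1)%R.
  have y1 := le_lt_trans (ltW (dbl_gt0 N 0)) y0.
  exists (Num.truncn (y * 2 ^+ N)%R); rewrite ler_pdivlMr ?exprn_gt0//.
  rewrite (le_trans (ltW (truncnS_gt _)))// -[leRHS]natrX ler_nat.
  by rewrite ltnW// ltn_expl.
have [m ym mmin] := ex_minnP ex.
exists m; rewrite -dblS; split => //.
case: m ym mmin => // m _ mmin; rewrite ltNge; apply/negP => /mmin.
by rewrite ltnn.
Qed.

(** Telescoping: [2^s - 1] times the s-th power of a level is the difference of the s-th powers of
    the next level and of this one. *)
Lemma geometric_dyadic N J s : (0 < s)%R ->
  ((2 `^ s - 1) * \sum_(j < J) dbl N j `^ s <= dbl N J `^ s)%R.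
Proof.
move=> s0; elim: J => [|J IH]; first by rewrite big_ord0 mulr0 powR_ge0.
by rewrite big_ord_recr/= dblS powRM ?(ltW (dbl_gt0 _ _))//; lra.
Qed.

(** If the last level is below [t], all indicators may be dropped and the telescoped bound is at
    most [(2 t)^s]; otherwise the last term vanishes. *)
Lemma geometric_dyadic_lt N J s t : (0 < s)%R -> (0 <= t)%R ->
  ((2 `^ s - 1) * \sum_(j < J) (dbl N j `^ s * (dbl N j < t)%R%:R) <=
   2 `^ s * t `^ s)%R.
Proof.
move=> s0 t0; elim: J => [|J IH]; first by rewrite big_ord0 mulr0 mulr_ge0// powR_ge0.
have b0 : (0 <= 2 `^ s - 1 :> R)%R.
  by rewrite subr_ge0 -[leLHS](powRr0 2); apply: ler_powR; rewrite ?ler1n// ltW.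
rewrite big_ord_recr/=; have [Jt|_] := ltP (dbl N J) t; last by rewrite mulr0 addr0.
apply: le_trans (le_trans (geometric_dyadic N J.+1 s0) _).
  rewrite ler_wpM2l// big_ord_recr/= mulr1 lerD2r ler_sum// => j _.
  by rewrite ler_piMr ?powR_ge0//; case: (_ < _)%R.
rewrite dblS powRM ?(ltW (dbl_gt0 _ _))// ler_wpM2l ?powR_ge0//.
by apply: ge0_ler_powR; rewrite ?nnegrE ?(ltW (dbl_gt0 _ _))// ltW.
Qed.

(** [2^s - 1 >= s ln 2] and [ln 2 >= 1/2]. With [s = p - 1] this is the origin of the factor
    [1 / (p - 1)]. *)
Lemma powR2_sub1_ge s : (0 <= s)%R -> (s / 2 <= 2 `^ s - 1 :> R)%R.
Proof.
move=> s0; rewrite lerBrDl /powR pnatr_eq0/=.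
apply: le_trans (expR_ge1Dx _); rewrite lerD2l ler_wpM2l//.
have := @le_ln1Dx R (- 2^-1)%R; rewrite (_ : 1 + - 2^-1 = 2^-1)%R; last by lra.
rewrite lnV ?posrE//; lra.
Qed.

Lemma nneseries_ge_term (u : nat -> \bar R) k : (forall j, 0 <= u j) ->
  u k <= \sum_(j <oo) u j.
Proof.
move=> u0; apply: le_trans (nneseries_lim_ge k.+1 _); last by move=> *; exact: u0.
by rewrite big_nat_recr//= leeDr// sume_ge0.
Qed.

(** The single level with [dbl N j < F <= 2 * dbl N j] already gives the bound. *)
Lemma poweR_le_dyadic N (F : \bar R) p : (0 < p)%R -> (dbl N 0)%:E < F ->
  F `^ p <=
  \sum_(j <oo) ((2 * dbl N j) `^ p * ((dbl N j)%:E < F)%E%:R)%:E.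
Proof.
move=> p0 uF; set S := \sum_(j <oo) _.
(* Stated for finite [y] below [F], so that the case [F = +oo] follows by letting [y] grow. *)
have yS y : (dbl N 0 < y)%R -> y%:E <= F -> (y `^ p)%:E <= S.
  move=> uy yF; have [j [jy yj]] := dyadic_above uy.
  apply: le_trans (nneseries_ge_term j _); last first.
    by move=> i; rewrite lee_fin mulr_ge0// powR_ge0.
  rewrite (lt_le_trans _ yF) ?lte_fin// mulr1 lee_fin.
  have y0 : (0 <= y)%R by rewrite (le_trans (ltW (dbl_gt0 N 0)))// ltW.
  by apply: ge0_ler_powR; rewrite ?nnegrE ?(le_trans y0 yj)// ltW.
case: F uF @S yS => [y| |] // uF S yS; first exact: yS.
rewrite poweRyr ?gt_eqF// leye_eq; apply/eqP/eqyP => r r0.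
apply: le_trans (yS (r `^ p^-1 + dbl N 0)%R _ _); rewrite ?leey//; last first.
  by rewrite ltrDr powR_gt0.
rewrite lee_fin -[leLHS](@powRr1 _ r (ltW r0)) -(mulVf (lt0r_neq0 p0)) powRrM.
have d0 := ltW (dbl_gt0 N 0).
by apply: ge0_ler_powR; rewrite ?nnegrE ?addr_ge0 ?powR_ge0 ?(ltW p0)// lerDl.
Qed.

(** One factor [g] is taken out, and a geometric sum of (p-1)-th powers of the halved levels below
    [g] remains. The constant is [32 = 8 * 4]: the coefficient [2 * 4^(p-1)] is at most 8 for
    [p <= 2], and the geometric sum is at most [4 g^(p-1) / (p-1)]. *)
Lemma dyadic_le_poweR N (g : \bar R) p : (1 < p)%R -> (p <= 2)%R -> 0 <= g ->
  \sum_(j <oo) (((2 * dbl N j) `^ p / dbl N j * ((dbl N j / 2)%:E < g)%E%:R)%:E * g) <=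
  (32 / (p - 1))%:E * g `^ p.
Proof.
move=> p1 p2 g0; have s0 : (0 < p - 1)%R by rewrite subr_gt0.
have c0 : (0 < 32 / (p - 1))%R by rewrite divr_gt0.
case: g g0 => [t| |] //; last first.
  by move=> _; rewrite poweRyr ?gt_eqF ?(lt_trans _ p1)// [leRHS]gt0_muley ?leey.
rewrite lee_fin => t0; rewrite poweR_EFin.
under eq_eseriesr do rewrite muleC.
rewrite nneseriesZl; last first.
  by move=> j _; rewrite lee_fin mulr_ge0// divr_ge0 ?powR_ge0// ltW// dbl_gt0.
rewrite muleC.
have [->|tN0] := eqVneq t 0%R; first by rewrite mule0 mule_ge0 ?lee_fin ?powR_ge0// ltW.
have tp0 : (0 < t)%R by rewrite lt_neqAle eq_sym tN0.
rewrite (_ : (t `^ p)%:E = (t `^ (p - 1))%:E * t%:E); last first.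
  rewrite -EFinM -[X in (_ * X)%R](powRr1 t0) -powRD ?subrK//.
  by rewrite (gt_eqF tp0) implybT.
rewrite muleA lee_wpmul2r ?lee_fin// -EFinM.
apply: lime_le.
  apply: is_cvg_nneseries => j _ _.
  by rewrite lee_fin mulr_ge0// divr_ge0 ?powR_ge0// (ltW (dbl_gt0 _ _)).
apply: nearW => J; rewrite sumEFin lee_fin big_mkord.
have b1 : ((p - 1) / 2 <= 2 `^ (p - 1) - 1 :> R)%R by apply: powR2_sub1_ge; exact: ltW.
have b2 : (2 `^ (p - 1) <= 2 :> R)%R.
  by rewrite -[leRHS]powRr1//; apply: ler_powR; rewrite ?ler1n//; lra.
have b0 : (0 < 2 `^ (p - 1) - 1 :> R)%R by apply: lt_le_trans b1; rewrite divr_gt0.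
(* Half the level [j] of cutoff [N] is the level [j] of cutoff [N.+1], which lets
   [geometric_dyadic_lt] apply. *)
have dE j : ((2 * dbl N j) `^ p / dbl N j =
    2 * (4 `^ (p - 1) * dbl N.+1 j `^ (p - 1)))%R.
  have d0 := dbl_gt0 N j.
  have -> : dbl N.+1 j = (dbl N j / 2)%R by rewrite /dbl exprS; field; rewrite expf_neq0//.
  rewrite -powRM//; last by rewrite divr_ge0// ltW.
  have -> : (4 * (dbl N j / 2) = 2 * dbl N j)%R by field.
  have -> : (p = (p - 1) + 1)%R by rewrite subrK.
  rewrite powRD ?addrK; last by rewrite mulf_neq0 ?implybT// gt_eqF.
  rewrite powRr1 ?mulr_ge0 ?(ltW d0)//; field.
  by rewrite gt_eqF.
under eq_bigr do rewrite dE.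
have -> : (\sum_(j < J) (2 * (4 `^ (p - 1) * dbl N.+1 j `^ (p - 1)) *
    ((dbl N j / 2)%:E < t%:E)%E%:R) = 2 * 4 `^ (p - 1) *
    \sum_(j < J) (dbl N.+1 j `^ (p - 1) * (dbl N.+1 j < t)%R%:R))%R.
  rewrite big_distrr/=; apply: eq_bigr => j _; rewrite lte_fin.
  have -> : dbl N.+1 j = (dbl N j / 2)%R by rewrite /dbl exprS; field; rewrite expf_neq0//.
  by rewrite !mulrA.
have := @geometric_dyadic_lt N.+1 J (p - 1) t s0 t0.
set S := (\sum_(j < J) _)%R => h.
have b4 : (4 `^ (p - 1) <= 4 :> R)%R.
  by rewrite -[leRHS]powRr1//; apply: ler_powR; rewrite ?ler1n//; lra.
have tp := @powR_ge0 R t (p - 1).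
have S0 : (0 <= S)%R by apply: sumr_ge0 => j _; rewrite mulr_ge0// powR_ge0.
have h1 : ((p - 1) / 2 * S <= 2 * t `^ (p - 1))%R.
  apply: le_trans (le_trans _ (le_trans h _)); first exact: lexx.
    by rewrite ler_wpM2r.
  by rewrite ler_wpM2r.
apply: (@le_trans _ _ (8 * S)%R); first by rewrite ler_wpM2r//; lra.
by rewrite mulrAC ler_pdivlMr//; lra.
Qed.

End dyadic_levels.

Lemma indicE_bool (R : pzRingType) (T : Type) (P : T -> bool) (x : T) :
  \1_[set x | P x] x = (P x)%:R :> R.
Proof. by rewrite indicE; congr ((nat_of_bool _)%:R); apply/idP/idP; rewrite inE. Qed.

(** * The strong type bound *)

Section maximal_strong_type.
Context {R : realType} {n : nat}.
Local Notation En := 'rV[R]_n.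
Local Notation leb := (@lebesgue_rV R n).
Implicit Types (g h : En -> \bar R) (p : R).

Lemma measurable_gt h (c : R) : measurable_fun setT h ->
  measurable [set x | c%:E < h x].
Proof. by move=> mh; rewrite -[X in measurable X]setTI; exact: emeasurable_fun_o_infty. Qed.

Lemma measurable_poweR_comp h (r : R) : measurable_fun setT h ->
  measurable_fun setT (fun x => h x `^ r).
Proof. by move=> mh; exact: (measurableT_comp (measurable_poweR r)). Qed.

(** Marcinkiewicz interpolation over dyadic levels: [H j] is the layer of the maximal function at
    level [j], and the weak type bound compares its integral with that of [G j]. In the constant,
    [64 = 2 * 32] with 2 from [maximal_weak_type] and 32 from [dyadic_le_poweR]. *)
Lemma maximal_strong_type g p : measurable_fun setT g -> (forall x, 0 <= g x) ->
  (1 < p)%R -> (p <= 2)%R ->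
  \int[leb]_x (maximal g x) `^ p <=
  (3 ^+ n * 64 / (p - 1))%:E * \int[leb]_x (g x) `^ p.
Proof.
move=> mg g0 p1 p2; have p0 : (0 < p)%R by exact: lt_trans p1.
set F := maximal g; have mF : measurable_fun setT F by exact: measurable_maximal.
have F0 x : 0 <= F x by exact: maximal_ge0.
(* The dyadic sum only controls [F] above the lowest level. The sets [E N] exhaust the points where
   [F > 0], and the bound is uniform in [N]. *)
pose E N := [set x | (dbl N 0)%:E < F x].
have mE N : measurable (E N) by exact: measurable_gt.
have ndE : nondecreasing_seq E.
  move=> N M NM; apply/subsetPset => x; rewrite /E/=; apply: le_lt_trans.
  by rewrite lee_fin /dbl !expr0 !div1r lef_pV2 ?posrE ?exprn_gt0// ler_weXn2l// ler1n.
have UE : \bigcup_N E N = [set x | 0 < F x].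
  apply/seteqP; split => [x [N _]|x] /=.
    by apply: le_lt_trans; rewrite lee_fin (ltW (dbl_gt0 _ _)).
  case Fx : (F x) => [y| |] //; last by exists 0%N => //; rewrite /E/= Fx ltry.
  rewrite lte_fin => y0; exists (Num.truncn y^-1).+1 => //.
  rewrite /E/= Fx lte_fin /dbl expr0 div1r invf_plt ?posrE ?exprn_gt0//.
  by rewrite (lt_le_trans (truncnS_gt _))// -natrX ler_nat ltnW// ltn_expl.
have mFp := measurable_poweR_comp p mF.
have -> : \int[leb]_x F x `^ p = \int[leb]_(x in \bigcup_N E N) F x `^ p.
  rewrite UE [RHS]integral_mkcond; apply: eq_integral => x _.
  rewrite patchE; case: ifPn => //; rewrite notin_setE/= => /negP.
  rewrite -leNgt => Fx; have -> : F x = 0 by apply/eqP; rewrite eq_le Fx F0.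
  by rewrite poweR0r// gt_eqF.
have := @ge0_nondecreasing_set_cvg_integral _ _ _ E (fun x => F x `^ p) leb ndE mE
  (fun N => measurable_funS measurableT (@subsetT _ _) mFp)
  (fun _ _ _ => @poweR_ge0 _ _ _).
apply: cvge_le; apply: nearW => N.
pose H j x := ((2 * dbl N j) `^ p * ((dbl N j)%:E < F x)%E%:R)%:E.
have HE j : H j = fun x => ((2 * dbl N j) `^ p)%:E * (\1_[set x | ((dbl N j)%:E < F x)%E] x)%:E.
  by apply/funext => x; rewrite /H EFinM indicE_bool.
have H0 j x : 0 <= H j x by rewrite lee_fin mulr_ge0// powR_ge0.
have mH j : measurable_fun setT (H j).
  rewrite HE; apply: measurable_funeM; apply/measurable_EFinP.
  by apply: measurable_indic; exact: measurable_gt.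
pose G j x := ((2 * dbl N j) `^ p / dbl N j * ((dbl N j / 2)%:E < g x)%E%:R)%:E * g x.
have GE j : G j = fun x => ((2 * dbl N j) `^ p / dbl N j)%:E *
    (g \_ [set x | (dbl N j / 2)%:E < g x]) x.
  apply/funext => x; rewrite /G patchE; case: ifPn.
    by rewrite inE/= => ->; rewrite mulr1.
  by rewrite notin_setE/= => /negP/negPf ->; rewrite mulr0 mul0e mule0.
have c0 j : (0 <= (2 * dbl N j) `^ p / dbl N j)%R.
  by rewrite divr_ge0 ?powR_ge0// ltW// dbl_gt0.
have G0 j x : 0 <= G j x.
  by rewrite mule_ge0// lee_fin mulr_ge0.
have mgE (c : R) : measurable_fun setT (g \_ [set x | c%:E < g x]).
  apply/(measurable_restrictT _ (measurable_gt c mg)).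
  exact: measurable_funS mg.
have mG j : measurable_fun setT (G j) by rewrite GE; exact: measurable_funeM.
apply: (@le_trans _ _ (\int[leb]_x \sum_(j <oo) H j x)).
  rewrite integral_mkcond; apply: ge0_le_integral => //.
  - by move=> x _; apply: erestrict_ge0 => *; exact: poweR_ge0.
  - apply/(measurable_restrictT _ (mE N)); exact: measurable_funS mFp.
  - by apply: (@ge0_emeasurable_sum _ _ _ _ H predT) => *.
  move=> x _; rewrite patchE; case: ifPn => [|_]; last exact: nneseries_ge0.
  by rewrite inE => /(poweR_le_dyadic p0).
rewrite integral_nneseries//.
have kG0 : (0 <= 3 ^+ n * 2 :> R)%R by rewrite mulr_ge0// exprn_ge0.
apply: (@le_trans _ _ (\sum_(j <oo) (3 ^+ n * 2)%:E * \int[leb]_x G j x)).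
  apply: lee_nneseries => [j _ _|j _]; first exact: integral_ge0.
  have d0 : (0 < dbl N j :> R)%R by exact: dbl_gt0.
  rewrite HE GE ge0_integralZl//; last 2 first.
  - by apply/measurable_EFinP; apply: measurable_indic; exact: measurable_gt.
  - by rewrite lee_fin powR_ge0.
  rewrite integral_indic//; last exact: measurable_gt.
  rewrite ge0_integralZl//; last 2 first.
  - by move=> x _; apply: erestrict_ge0 => *; exact: g0.
  - by rewrite lee_fin.
  rewrite setIT -integral_mkcond.
  have := maximal_weak_type mg g0 d0.
  move=> /(lee_wpmul2l (x := ((2 * dbl N j) `^ p)%:E)).
  rewrite lee_fin powR_ge0 => /(_ isT) /le_trans; apply.
  rewrite !muleA -!EFinM lee_wpmul2r ?integral_ge0// lee_fin.
  by rewrite le_eqVlt; apply/orP; left; apply/eqP; field; rewrite gt_eqF.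
rewrite nneseriesZl; last by move=> *; exact: integral_ge0.
rewrite -integral_nneseries//.
apply: (@le_trans _ _ ((3 ^+ n * 2)%:E *
    \int[leb]_x ((32 / (p - 1))%:E * (g x) `^ p))).
  rewrite lee_wpmul2l ?lee_fin//; apply: ge0_le_integral => //.
  - by move=> x _; exact: nneseries_ge0.
  - by apply: (@ge0_emeasurable_sum _ _ _ _ G predT) => *.
  - by apply: measurable_funeM; exact: measurable_poweR_comp.
  by move=> x _; exact: dyadic_le_poweR.
have p10 : (0 <= p - 1)%R by rewrite subr_ge0 ltW.
rewrite ge0_integralZl//; last 3 first.
- exact: measurable_poweR_comp.
- by move=> *; exact: poweR_ge0.
- by rewrite lee_fin divr_ge0.
rewrite muleA -EFinM lee_wpmul2r//; last by rewrite lee_fin; lra.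
by apply: integral_ge0 => *; exact: poweR_ge0.
Qed.

End maximal_strong_type.

(** * The Rubio de Francia series *)

Section rubio_de_francia.
Context {R : realType} {n : nat}.
Local Notation En := 'rV[R]_n.
Local Notation leb := (@lebesgue_rV R n).
Implicit Types (g h : En -> \bar R) (q : R).

Lemma average_nneseries (a : En) (l : R) (u : nat -> En -> \bar R) : (0 < l)%R ->
  (forall k, measurable_fun setT (u k)) -> (forall k x, 0 <= u k x) ->
  average (cube a l) (fun x => \sum_(k <oo) u k x) =
  \sum_(k <oo) average (cube a l) (u k).
Proof.
move=> l0 mu u0; rewrite averageE// integral_nneseries//.
  rewrite -nneseriesZl; last by move=> k _; exact: integral_ge0.
  by apply: eq_eseriesr => k _; rewrite averageE.
by move=> k; exact: measurable_funS (mu k).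
Qed.

Lemma average_scale (a : En) (l c : R) g : (0 < l)%R -> (0 <= c)%R ->
  measurable_fun setT g -> (forall x, 0 <= g x) ->
  average (cube a l) (fun x => c%:E * g x) = c%:E * average (cube a l) g.
Proof.
move=> l0 c0 mg g0; rewrite !averageE// ge0_integralZl//.
  by rewrite muleCA.
exact: measurable_funS mg.
Qed.

Lemma maximal_nneseries (c : nat -> R) (u : nat -> En -> \bar R) x :
  (forall k, (0 <= c k)%R) ->
  (forall k, measurable_fun setT (u k)) -> (forall k x, 0 <= u k x) ->
  maximal (fun x => \sum_(k <oo) (c k)%:E * u k x) x <=
  \sum_(k <oo) (c k)%:E * maximal (u k) x.
Proof.
move=> c0 mu u0; apply: ge_ereal_sup => _ [j _ <-]; rewrite patchE.
have S0 k : 0 <= (c k)%:E * maximal (u k) x.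
  by rewrite mule_ge0 ?lee_fin// maximal_ge0.
case: ifPn => [/[!inE] jx|_]; last exact: nneseries_ge0.
have s0 := @qside_gt0 R n j.
rewrite average_nneseries//; last 2 first.
- by move=> k; exact: measurable_funeM.
- by move=> k y; rewrite mule_ge0 ?lee_fin.
apply: lee_nneseries => [k _ _|k _].
  by apply: average_ge0 => y; rewrite mule_ge0 ?lee_fin.
rewrite average_scale// lee_wpmul2l ?lee_fin//.
exact: average_le_maximal.
Qed.

Lemma nneseries_half (c : \bar R) : 0 <= c ->
  \sum_(k <oo) ((2^-1) ^+ k)%:E * c <= 2%:E * c.
Proof.
case: c => [c c0| _|//]; last by rewrite [leRHS]gt0_muley ?leey.
under eq_eseriesr do rewrite muleC.
rewrite nneseriesZl; last by move=> k _; rewrite lee_fin exprn_ge0.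
rewrite muleC lee_wpmul2r//; apply: lime_le.
  by apply: is_cvg_nneseries => k _ _; rewrite lee_fin exprn_ge0.
apply: nearW => J; rewrite sumEFin lee_fin big_mkord.
suff -> : (\sum_(i < J) 2^-1 ^+ i = 2 - 2 * 2^-1 ^+ J :> R)%R.
  by rewrite lerBlDr lerDl mulr_ge0// exprn_ge0.
elim: J => [|J IH]; first by rewrite big_ord0 expr0; lra.
by rewrite big_ord_recr/= IH exprS; lra.
Qed.

(** The constant for integrals of q-th powers; being at least 1, it also bounds its own q-th
    root. *)
Definition rdf_cst q : R := (3 ^+ n * 64 / (q - 1))%R.

(** The ratio is [4 K] because the pointwise bound inside [integral_rdf] costs [(2 K)^k] and a
    factor [2^-k] must remain. *)
Definition rdf q h (x : En) : \bar R :=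
  \sum_(k <oo) ((4 * rdf_cst q)^-1 ^+ k)%:E * iter k maximal h x.

Variables (q : R) (h : En -> \bar R).
Hypotheses (q1 : (1 < q)%R) (q2 : (q <= 2)%R).
Hypotheses (mh : measurable_fun setT h) (h0 : forall x, 0 <= h x).

Local Notation K := (rdf_cst q).
Local Notation W := (rdf q h).

Let q0 : (0 < q)%R. Proof. exact: lt_trans q1. Qed.

Lemma rdf_cst_ge1 : (1 <= K)%R.
Proof.
have q10 : (0 < q - 1)%R by rewrite subr_gt0.
rewrite /rdf_cst ler_pdivlMr// mul1r.
have : (1 <= 3 ^+ n :> R)%R by rewrite exprn_ege1// ler1n.
move: (3 ^+ n)%R (q2) => z *; lra.
Qed.

Let K0 : (0 < K)%R. Proof. exact: lt_le_trans rdf_cst_ge1. Qed.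

Let mI k : measurable_fun setT (iter k maximal h).
Proof. by case: k => //= k; exact: measurable_maximal. Qed.

Let I0 k x : 0 <= iter k maximal h x.
Proof. by elim: k x => //= k IH x; exact: maximal_ge0. Qed.

Let c0 k : (0 <= (4 * K)^-1 ^+ k)%R.
Proof. by rewrite exprn_ge0// invr_ge0 mulr_ge0// ltW. Qed.

Let t0 k x : 0 <= ((4 * K)^-1 ^+ k)%:E * iter k maximal h x.
Proof. by rewrite mule_ge0// lee_fin. Qed.

Lemma rdf_ge0 x : 0 <= W x.
Proof. exact: nneseries_ge0. Qed.

Lemma measurable_rdf : measurable_fun setT W.
Proof.
apply: (@ge0_emeasurable_sum _ _ _ _
  (fun k x => ((4 * K)^-1 ^+ k)%:E * iter k maximal h x) predT) => // k _.
exact: measurable_funeM.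
Qed.

Lemma le_rdf x : h x <= W x.
Proof.
apply: le_trans (nneseries_ge_term 0%N (fun k => t0 k x)).
by rewrite expr0 mul1e.
Qed.

(** Applying the maximal function term by term shifts the series by one index, which costs one
    factor [4 K]; the term of index 0 is then added for free. *)
Lemma maximal_rdf x : maximal W x <= (4 * K)%:E * W x.
Proof.
apply: (le_trans (maximal_nneseries _ c0 mI I0)).
rewrite -nneseriesZl//.
apply: lime_le.
  by apply: is_cvg_nneseries => k _ _; rewrite mule_ge0 ?lee_fin// maximal_ge0.
apply: nearW => J.
apply: le_trans (nneseries_lim_ge J.+1 _); last first.
  by move=> k _ _; apply: mule_ge0; [rewrite lee_fin mulr_ge0// ltW|exact: t0].
rewrite big_nat_recl//= -[leLHS]add0e leeD//.
  by apply: mule_ge0; [rewrite lee_fin mulr_ge0// ltW|exact: (t0 0%N)].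
apply: lee_sum => k _; rewrite muleA -EFinM exprS mulVKf//.
by rewrite mulf_neq0// gt_eqF.
Qed.

Lemma integral_iter_maximal k :
  \int[leb]_x (iter k maximal h x `^ q) <= (K ^+ k)%:E * \int[leb]_x (h x `^ q).
Proof.
elim: k => [|k IH]; first by rewrite expr0 mul1e.
apply: (le_trans (maximal_strong_type (mI k) (I0 k) q1 q2)).
rewrite -/(rdf_cst q) [in leRHS]exprS [in leRHS]EFinM -[leRHS]muleA.
by rewrite lee_wpmul2l// lee_fin ltW.
Qed.

(* With S the sum of the (2K)^-k (M^k h)^q, every M^k h is at most
   (2K)^k S^(1/q), so that W <= 2 S^(1/q): no Minkowski inequality is needed. *)
Lemma integral_rdf : \int[leb]_x (W x `^ q) <= 8%:E * \int[leb]_x (h x `^ q).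
Proof.
pose S x := \sum_(k <oo) ((2 * K)^-1 ^+ k)%:E * iter k maximal h x `^ q.
have d0 k : (0 < (2 * K)^-1 ^+ k)%R by rewrite exprn_gt0// invr_gt0 mulr_gt0.
have s0 k x : 0 <= ((2 * K)^-1 ^+ k)%:E * iter k maximal h x `^ q.
  by rewrite mule_ge0 ?poweR_ge0// lee_fin ltW.
have ms k : measurable_fun setT
    (fun x => ((2 * K)^-1 ^+ k)%:E * iter k maximal h x `^ q).
  by apply: measurable_funeM; exact: measurable_poweR_comp.
have mS : measurable_fun setT S.
  exact: (@ge0_emeasurable_sum _ _ _ _ (fun k x => _) predT).
have S0 x : 0 <= S x by exact: nneseries_ge0.
have IS k x : iter k maximal h x <= ((2 * K) ^+ k)%:E * S x `^ q^-1.
  have := nneseries_ge_term k (fun k => s0 k x); rewrite -/(S x) => H.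
  have : iter k maximal h x `^ q <= ((2 * K) ^+ k)%:E * S x.
    by move: H; rewrite exprVn lee_pdivrMl// exprn_gt0// mulr_gt0.
  have q0' : (0 <= q^-1)%R by rewrite invr_ge0 ltW.
  move=> /(ge0_le_poweR q0' (poweR_ge0 _ _)).
  rewrite -poweRrM mulfV ?gt_eqF// poweRe1// => /le_trans; apply.
  have K1 : (1 <= (2 * K) ^+ k)%R.
    by rewrite exprn_ege1//; have := rdf_cst_ge1; lra.
  rewrite poweRM//; last by rewrite lee_fin (le_trans ler01).
  rewrite lee_wpmul2r ?poweR_ge0// poweR_EFin lee_fin.
  rewrite -[leRHS]powRr1 ?(le_trans ler01)//.
  by apply: ler_powR => //; rewrite invf_le1// ltW.
have WS x : W x <= 2%:E * S x `^ q^-1.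
  apply: le_trans (nneseries_half (poweR_ge0 _ _)).
  apply: lee_nneseries => // k _.
  apply: (@le_trans _ _ (((4 * K)^-1 ^+ k)%:E * (((2 * K) ^+ k)%:E * S x `^ q^-1))).
    by rewrite lee_wpmul2l ?lee_fin.
  rewrite muleA -EFinM -exprMn (_ : (4 * K)^-1 * (2 * K) = 2^-1)%R//.
  by field; rewrite gt_eqF.
apply: (@le_trans _ _ (\int[leb]_x ((2 `^ q)%:E * S x))).
  apply: ge0_le_integral => //.
  - by move=> x _; exact: poweR_ge0.
  - by apply: measurable_poweR_comp; exact: measurable_rdf.
  - exact: measurable_funeM.
  move=> x _; have := ge0_le_poweR (ltW q0) (rdf_ge0 x) (WS x).
  rewrite poweRM ?poweR_ge0// poweR_EFin -poweRrM mulVf ?gt_eqF// poweRe1//.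
rewrite ge0_integralZl// ?lee_fin ?powR_ge0//.
rewrite integral_nneseries//.
have Ih0 : 0 <= \int[leb]_x (h x `^ q).
  by apply: integral_ge0 => *; exact: poweR_ge0.
(* [8 = 4 * 2]: [2^q <= 4] since [q <= 2], and the series of [(2 K)^-k K^k = 2^-k] sums to 2. *)
apply: (@le_trans _ _ (4%:E * (2%:E * \int[leb]_x (h x `^ q)))); last first.
  have -> : 8%:E = 4%:E * 2%:E :> \bar R by rewrite -EFinM; congr EFin; lra.
  by rewrite muleA.
apply: lee_pmul.
- by rewrite lee_fin powR_ge0.
- by apply: nneseries_ge0 => k _ _; exact: integral_ge0.
- rewrite lee_fin (_ : 4 = 2 `^ 2%:R)%R; last by rewrite powR_mulrn//; lra.
  by apply: ler_powR => //; rewrite ler1n.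
apply: le_trans (nneseries_half Ih0).
apply: lee_nneseries => [k _ _|k _]; first exact: integral_ge0.
rewrite ge0_integralZl//; last 3 first.
- exact: measurable_poweR_comp.
- by move=> *; exact: poweR_ge0.
- by rewrite lee_fin ltW.
have d1 : 0 <= ((2 * K)^-1 ^+ k)%:E by rewrite lee_fin ltW.
apply: (le_trans (lee_wpmul2l d1 (integral_iter_maximal k))).
rewrite muleA -EFinM -exprMn (_ : (2 * K)^-1 * K = 2^-1)%R//.
by field; rewrite gt_eqF.
Qed.

(** The A_1 condition for arbitrary cubes: pass to a covering rational cube, then use
    [maximal_rdf]. *)
Lemma average_rdf (a : En) (l : R) x : (0 < l)%R -> cube a l x ->
  average (cube a l) W <= (2 ^+ n * (4 * K))%:E * W x.
Proof.
move=> l0 ax; have [k [ak kl]] := cube_sub_qcube a l0.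
have s0 := @qside_gt0 R n k.
rewrite EFinM -muleA.
apply: (@le_trans _ _ ((2 ^+ n)%:E * average (qcube k) W)); last first.
  rewrite lee_wpmul2l ?lee_fin ?exprn_ge0//.
  apply: le_trans (maximal_rdf x).
  exact/average_le_maximal/ak.
rewrite !averageE// muleA -EFinM; apply: lee_pmul.
- by rewrite lee_fin invr_ge0 exprn_ge0// ltW.
- by apply: integral_ge0 => *; exact: rdf_ge0.
- rewrite lee_fin -exprVn -exprVn -exprMn.
  apply: lerXn2r; rewrite ?nnegrE ?invr_ge0 ?mulr_ge0 ?invr_ge0 ?(ltW l0) ?(ltW s0)//.
  by rewrite ler_pdivlMr// mulrC ler_pdivrMr// mulrC.
apply: ge0_subset_integral => //.
- by apply: measurable_funS measurable_rdf.
- by move=> *; exact: rdf_ge0.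
Qed.

End rubio_de_francia.

(** * A_1 and A_p constants *)

Section integral_ge0.
Context d (T : measurableType d) (R : realType) (mu : {measure set T -> \bar R}).
Implicit Types (f : T -> \bar R) (A B : set T).

Lemma ge0_integral_eq0_ae f : measurable_fun setT f -> (forall x, 0 <= f x) ->
  \int[mu]_x f x = 0 -> \forall x \ae mu, f x = 0.
Proof.
move=> mf f0 If.
have := (ae_eq_integral_abs mu measurableT mf).1.
rewrite (eq_integral f); last by move=> x _; rewrite gee0_abs.
by move=> /(_ If); apply: filterS => x /= /(_ I).
Qed.

Lemma ge0_integral_lty_ae f : measurable_fun setT f -> (forall x, 0 <= f x) ->
  \int[mu]_x f x < +oo -> \forall x \ae mu, f x < +oo.
Proof.
move=> mf f0 If.
have fi : mu.-integrable setT f.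
  apply/integrableP; split => //.
  by rewrite (eq_integral f)// => x _; rewrite gee0_abs.
have := integrable_ae measurableT fi; apply: filterS => x /(_ I).
by rewrite ge0_fin_numE.
Qed.

(* Needed for [is_weight], which integrates over compact sets: these are not shown
   to be measurable for the coordinate sigma-algebra. *)
Lemma ge0_integral_subset A B f : (forall x, 0 <= f x) -> A `<=` B ->
  \int[mu]_(x in A) f x <= \int[mu]_(x in B) f x.
Proof.
move=> f0 AB; rewrite integral_mkcond [leRHS]integral_mkcond.
rewrite !ge0_integralTE//; last 2 first.
- by move=> x; apply: erestrict_ge0 => *; exact: f0.
- by move=> x; apply: erestrict_ge0 => *; exact: f0.
apply: ereal_sup_le => _ [h /= hf <-]; exists h => // x /=.
apply: le_trans (hf x) _; rewrite !patchE; case: ifPn => [xA|_].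
  by rewrite ifT//; rewrite inE in xA; rewrite inE; exact: AB.
by case: ifPn.
Qed.

End integral_ge0.

Section a_one_weights.
Context {R : realType} {n : nat}.
Local Notation En := 'rV[R]_n.
Local Notation leb := (@lebesgue_rV R n).
Implicit Types (w W : En -> R) (a : En) (l p s A : R).

(** The condition holds only a.e. because the real-valued weight built later agrees with [rdf]
    outside a null set. The null set may depend on the cube, since cubes are always treated one at a
    time. *)
Definition A1_bound A w := forall a l, (0 < l)%R -> {ae leb, forall x, cube a l x ->
  average (cube a l) (EFin \o w) <= (A * w x)%:E}.

Lemma ae_cube_exists a l (P : En -> Prop) : (0 < l)%R ->
  {ae leb, forall x, cube a l x -> P x} -> exists x, cube a l x /\ P x.
Proof.
move=> l0 aeP; apply: contrapT => /forallNP nP.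
have : leb.-negligible (cube a l).
  apply: negligibleS aeP => x ax /= Px; apply: (nP x); split => //; exact: Px.
move=> /(measure_negligible (measurable_cube a l)).
rewrite [X in X = _](_ : _ = leb (cube a l))// lebesgue_cube ?(ltW l0)//.
by move=> /eqP; rewrite eqe gt_eqF// exprn_gt0.
Qed.

Lemma average_le_ae a l (f g : En -> \bar R) : (0 < l)%R ->
  measurable_fun setT f -> measurable_fun setT g ->
  (forall x, 0 <= f x) -> (forall x, 0 <= g x) ->
  {ae leb, forall x, cube a l x -> f x <= g x} ->
  average (cube a l) f <= average (cube a l) g.
Proof.
move=> l0 mf mg f0 g0 fg; rewrite !averageE// lee_wpmul2l//.
  by rewrite lee_fin invr_ge0 exprn_ge0// ltW.
apply: ae_ge0_le_integral => //.
- exact: measurable_funS mf.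
- exact: measurable_funS mg.
Qed.

Lemma average_cst a l (c : R) : (0 < l)%R -> average (cube a l) (cst c%:E) = c%:E.
Proof.
move=> l0; rewrite averageE// integral_cst//.
rewrite [X in _ * (_ * X)](_ : _ = (l ^+ n)%:E); last exact/lebesgue_cube/ltW.
by rewrite muleCA -EFinM mulVf ?mulr1// lt0r_neq0// exprn_gt0.
Qed.

(** Jensen's inequality for a concave power, as Hölder's inequality against the constant 1. *)
Lemma average_poweR_le a l w (t : R) : (0 < l)%R -> (0 < t)%R -> (t < 1)%R ->
  measurable_fun setT w -> (forall x, (0 <= w x)%R) ->
  average (cube a l) (fun x => (w x `^ t)%:E) <=
  average (cube a l) (EFin \o w) `^ t.
Proof.
move=> l0 t0 t1 mw w0; have ln0 : (0 < l ^+ n)%R by rewrite exprn_gt0.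
have Q0 : 0 <= (l ^+ n)^-1%:E by rewrite lee_fin invr_ge0 ltW.
have I0 : 0 <= \int[leb]_(x in cube a l) (w x)%:E.
  by apply: integral_ge0 => x _; rewrite lee_fin.
rewrite !averageE// poweRM//.
have mwQ : measurable_fun (cube a l) w by exact: measurable_funS mw.
have m1 : measurable_fun (cube a l) (fun=> 1%R : R) by exact: measurable_cst.
have := hoelder_powR leb (measurable_cube a l) mwQ
  m1 (fun x _ => w0 x) (fun _ _ => ler01) t0 t1.
under eq_integral do rewrite powR1 mulr1.
rewrite integral_cst// mul1e [X in _ * X `^ _](_ : _ = (l ^+ n)%:E); last first.
  exact/lebesgue_cube/ltW.
move=> /(lee_wpmul2l Q0) /le_trans; apply.
rewrite muleC -muleA [leRHS]muleC lee_wpmul2l ?poweR_ge0//.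
rewrite !poweR_EFin -EFinM lee_fin.
rewrite -[X in (_ * X <= _)%R]powR_inv1 ?(ltW ln0)//.
rewrite -[X in (_ <= X `^ _)%R]powR_inv1 ?(ltW ln0)// -powRrM -powRD; last first.
  by rewrite (gt_eqF ln0) implybT.
by rewrite mulN1r; have -> : (1 - t + -1 = - t)%R by ring.
Qed.

Lemma A1_average_lty A w a l : A1_bound A w -> (0 < l)%R ->
  average (cube a l) (EFin \o w) < +oo.
Proof.
move=> A1 l0; have [x [_ /le_lt_trans]] := ae_cube_exists l0 (A1 a l l0).
by apply; rewrite ltry.
Qed.

Lemma integral_cube_lty a l (f : En -> \bar R) : (0 < l)%R -> (forall x, 0 <= f x) ->
  (average (cube a l) f < +oo) = (\int[leb]_(x in cube a l) f x < +oo).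
Proof.
move=> l0 f0; have ln0 : (0 < l ^+ n)%R by rewrite exprn_gt0.
rewrite averageE//; have : 0 <= \int[leb]_(x in cube a l) f x by exact: integral_ge0.
case: (\int[leb]_(x in _) _) => [r| |]//= _; rewrite ?ltry//.
by rewrite gt0_muley// lte_fin invr_gt0.
Qed.

Lemma is_weight_cube w : measurable_fun setT w -> (forall x, (0 <= w x)%R) ->
  (forall a l, (0 < l)%R -> average (cube a l) (EFin \o w) < +oo) -> is_weight w.
Proof.
move=> mw w0 Qw; split => // C /compact_sub_big_cube[N CN].
apply: le_lt_trans (ge0_integral_subset _ _ CN) _; first by move=> x; rewrite lee_fin.
have N0 : (0 < 2 * N.+1%:R :> R)%R by rewrite mulr_gt0.
have := Qw (const_mx (- N.+1%:R)%R) _ N0; rewrite integral_cube_lty//.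
Qed.

Lemma conj_exponentB p : (1 < p)%R -> (1 - conj_exponent p = - (p - 1)^-1)%R.
Proof.
by move=> p1; rewrite /conj_exponent; field; rewrite !gt_eqF//; lra.
Qed.

Lemma dual_weightE p w x : (1 < p)%R -> (0 < w x)%R ->
  dual_weight p w x = (w x `^ (- (p - 1)^-1))%:E.
Proof. by move=> p1 w0; rewrite /dual_weight gt_eqF// conj_exponentB. Qed.

Lemma dual_weight_ge0 p w x : 0 <= dual_weight p w x.
Proof. by rewrite /dual_weight; case: ifP => // _; rewrite lee_fin powR_ge0. Qed.

Lemma measurable_dual_weight p w : measurable_fun setT w ->
  measurable_fun setT (dual_weight p w).
Proof.
move=> mw; apply: measurable_fun_ifT => //.
  exact: measurable_fun_eqr.
by apply/measurable_EFinP; exact: measurable_powRl.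
Qed.

Lemma Ap_const_le p w (B : \bar R) :
  (forall a l, (0 < l)%R -> average (cube a l) (EFin \o w) *
     average (cube a l) (dual_weight p w) `^ (p - 1) <= B) -> Ap_const p w <= B.
Proof. by move=> wB; apply: ge_ereal_sup => _ [[a l] /= l0 <-]; exact: wB. Qed.

Lemma A1_is_weight A w : measurable_fun setT w -> (forall x, (0 <= w x)%R) ->
  A1_bound A w -> is_weight w.
Proof.
move=> mw w0 A1; apply: is_weight_cube => // a l l0.
exact: A1_average_lty A1 _.
Qed.

(** If [m] is the average of [w], then [w >= m / A] a.e. on the cube, so the second factor of the
    A_p product is at most [A / m]. *)
Lemma A1_Ap_const A p w : (0 < A)%R -> (1 < p)%R ->
  measurable_fun setT w -> (forall x, (0 <= w x)%R) ->
  A1_bound A w -> Ap_const p w <= A%:E.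
Proof.
move=> A0 p1 mw w0 A1; apply: Ap_const_le => a l l0.
have p10 : (0 < p - 1)%R by rewrite subr_gt0.
have := A1_average_lty a A1 l0; have := A1 a l l0.
have : 0 <= average (cube a l) (EFin \o w).
  by apply: average_ge0 => x; rewrite lee_fin.
case: (average _ (EFin \o w)) => [m| |]// m0 aeA _.
(* Here [w] vanishes a.e. on the cube and the dual average is infinite; the product is 0 by the
   convention [0 * +oo = 0]. *)
have [->|mN0] := eqVneq m 0%R; first by rewrite mul0e lee_fin ltW.
have {mN0}m0 : (0 < m)%R by rewrite lt_neqAle eq_sym mN0.
have mA0 : (0 < m / A)%R by rewrite divr_gt0.
have : average (cube a l) (dual_weight p w) <= ((m / A) `^ (- (p - 1)^-1))%:E.
  rewrite -(average_cst a _ l0); apply: average_le_ae => //.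
  - exact: measurable_dual_weight.
  - exact: dual_weight_ge0.
  - by move=> x; rewrite lee_fin powR_ge0.
  apply: filterS aeA => x /= wx ax; have {}wx := wx ax.
  rewrite lee_fin mulrC -ler_pdivrMr// in wx.
  have wx0 : (0 < w x)%R by exact: lt_le_trans wx.
  rewrite dual_weightE// lee_fin !powRN lef_pV2 ?posrE ?powR_gt0//.
  by apply: ge0_ler_powR; rewrite ?nnegrE ?invr_ge0 ?(ltW p10) ?(ltW mA0) ?(ltW wx0).
move=> h; have h2 := ge0_le_poweR (ltW p10) (average_ge0 _ (@dual_weight_ge0 p w)) h.
have m0' : 0 <= m%:E by rewrite lee_fin ltW.
apply: (le_trans (lee_wpmul2l m0' h2)).
rewrite poweR_EFin -powRrM mulNr mulVf ?gt_eqF// powR_inv1 ?(ltW mA0)//.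
by rewrite -EFinM lee_fin invf_div mulrC divfK// gt_eqF.
Qed.

(** With [m] the average of [w], the lower bound [w >= m / A] makes the average of [w^(-s)] at most
    [A^s m^(-s)]. The dual weight of [w^(-s)] is [w^t] with [t = s / (p - 1) < 1], so Jensen bounds
    the second factor by [m^s]. *)
Lemma negpow_weight A p s w : (0 < A)%R -> (1 < p)%R -> (0 < s)%R -> (s < p - 1)%R ->
  measurable_fun setT w -> (forall x, (0 <= w x)%R) ->
  {ae leb, forall x, (0 < w x)%R} -> A1_bound A w ->
  is_weight (fun x => (w x `^ (- s))%R) /\
  Ap_const p (fun x => (w x `^ (- s))%R) <= (A `^ s)%:E.
Proof.
move=> A0 p1 s0 sp mw w0 wpos A1; have p10 : (0 < p - 1)%R by rewrite subr_gt0.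
set v := fun x => _; have mv : measurable_fun setT v by exact: measurable_powRl.
have v0 x : (0 <= v x)%R by exact: powR_ge0.
have key a l : (0 < l)%R -> exists m : R,
    [/\ average (cube a l) (EFin \o w) = m%:E, (0 < m)%R &
     average (cube a l) (EFin \o v) <= ((m / A) `^ (- s))%:E].
  move=> l0; have := A1_average_lty a A1 l0; have := A1 a l l0.
  (* A zero average would make [w] vanish a.e. on a cube of positive measure, against [wpos]. *)
  have : average (cube a l) (EFin \o w) != 0.
    apply/negP; rewrite averageE// mule_eq0 eqe gt_eqF ?invr_gt0 ?exprn_gt0//=.
    move=> /eqP; rewrite integral_mkcond => /ge0_integral_eq0_ae.
    move=> H; have {}H : {ae leb, forall x, cube a l x -> False}.
      have {}H : \forall x \ae leb, ((EFin \o w) \_ (cube a l)) x = 0.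
        apply: H.
        - apply/(measurable_restrictT _ (measurable_cube a l)).
          by apply/measurable_EFinP; exact: measurable_funS mw.
        - by move=> x; apply: erestrict_ge0 => y _; rewrite lee_fin.
      apply: filterS2 H wpos => x; rewrite patchE => /[swap] wx /[swap] ax.
      by rewrite mem_set// => -[wx0]; rewrite wx0 ltxx in wx.
    by have [x []] := ae_cube_exists l0 H.
  have : 0 <= average (cube a l) (EFin \o w).
    by apply: average_ge0 => x; rewrite lee_fin.
  case: (average _ (EFin \o w)) => [m| |]// m0 mN0 aeA _.
  have {mN0}m0 : (0 < m)%R by rewrite lt_neqAle eq_sym -eqe mN0.
  exists m; split => //; have mA0 : (0 < m / A)%R by rewrite divr_gt0.
  rewrite -(average_cst a _ l0); apply: average_le_ae => //.
  - exact/measurable_EFinP.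
  - by move=> x; rewrite lee_fin powR_ge0.
  apply: filterS aeA => x /= wx ax; have {}wx := wx ax.
  rewrite lee_fin mulrC -ler_pdivrMr// in wx.
  have wx0 : (0 < w x)%R by exact: lt_le_trans wx.
  rewrite lee_fin /v !powRN lef_pV2 ?posrE ?powR_gt0//.
  by apply: ge0_ler_powR; rewrite ?nnegrE ?(ltW s0) ?(ltW mA0) ?(ltW wx0).
split.
  apply: is_weight_cube => // a l /(key a)[m [_ _ /le_lt_trans]].
  by apply; rewrite ltry.
apply: Ap_const_le => a l l0; have [m [mE m0 vm]] := key a l l0.
pose t := (s / (p - 1))%R.
have t0 : (0 < t)%R by rewrite divr_gt0.
have t1 : (t < 1)%R by rewrite ltr_pdivrMr// mul1r.
have dm : average (cube a l) (dual_weight p v) <= (m `^ t)%:E.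
  apply: (@le_trans _ _ (average (cube a l) (fun x => (w x `^ t)%:E))).
    apply: average_le_ae => //.
    - exact: measurable_dual_weight.
    - by apply/measurable_EFinP; exact: measurable_powRl.
    - exact: dual_weight_ge0.
    - by move=> x; rewrite lee_fin powR_ge0.
    apply: filterS wpos => x wx _; rewrite dual_weightE ?powR_gt0//.
    by rewrite lee_fin /v -powRrM mulrNN.
  by apply: (le_trans (average_poweR_le a l0 t0 t1 mw w0)); rewrite mE.
have := ge0_le_poweR (ltW p10) (average_ge0 _ (@dual_weight_ge0 p v)) dm.
rewrite poweR_EFin -powRrM divfK ?gt_eqF// => dm2.
apply: le_trans (lee_pmul _ _ vm dm2) _; rewrite ?poweR_ge0//.
  by apply: average_ge0 => x; rewrite /= lee_fin v0.
rewrite -EFinM lee_fin powRM ?invr_ge0 ?(ltW m0) ?(ltW A0)//.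
rewrite -[X in (_ * X `^ _ * _ <= _)%R]powR_inv1 ?(ltW A0)// -powRrM mulrNN mul1r.
by rewrite mulrAC powRN mulVf ?mul1r// gt_eqF// powR_gt0.
Qed.

End a_one_weights.

(** * Real-valued majorants *)

Section rdf_majorant.
Context {R : realType} {n : nat}.
Local Notation En := 'rV[R]_n.
Local Notation leb := (@lebesgue_rV R n).

Definition rdf_A1 (q : R) : R := (2 ^+ n * (4 * rdf_cst (n := n) q))%R.

(** If [rdf q h] vanished at one point, [average_rdf] would make its average vanish on every cube
    around that point; it would then be zero a.e., and so would [h]. *)
Lemma rdf_gt0 (q : R) (h : En -> \bar R) : (1 < q)%R -> (q <= 2)%R ->
  measurable_fun setT h -> (forall x, 0 <= h x) ->
  0 < \int[leb]_x (h x `^ q) -> forall x, 0 < rdf q h x.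
Proof.
move=> q1 q2 mh h0 hq x; rewrite lt_neqAle rdf_ge0// andbT eq_sym; apply/eqP => Wx.
have W0 := rdf_ge0 q1 q2 h0; have mW := measurable_rdf q1 q2 mh h0.
have [N NP] := big_cube_absorb x.
have IN M : (N < M)%N -> \int[leb]_(y in big_cube M) rdf q h y = 0.
  move=> NM; have M0 : (0 < 2 * M%:R :> R)%R.
    by rewrite mulr_gt0// ltr0n (leq_trans _ NM).
  have := average_rdf q1 q2 mh h0 M0 (NP M (ltnW NM)).
  rewrite Wx mule0 averageE// pmule_rle0 ?lte_fin ?invr_gt0 ?exprn_gt0// => H.
  by apply/eqP; rewrite eq_le H integral_ge0.
have := @ge0_nondecreasing_set_cvg_integral _ _ _ _ (rdf q h) leb big_cube_ndecr
  (fun M => measurable_cube _ _) (fun M => measurable_funS measurableT (@subsetT _ _) mW)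
  (fun _ x _ => W0 x).
rewrite bigcup_big_cube => cv.
have IW : \int[leb]_x rdf q h x = 0.
  apply/eqP; rewrite eq_le integral_ge0// andbT.
  apply: (cvge_le _ cv).
  by exists N.+1 => // M /= NM; rewrite IN.
have hq0 : \int[leb]_y (h y `^ q) <= \int[leb]_y (cst 0 y).
  have q0 : (0 < q)%R by exact: lt_trans q1.
  apply: ae_ge0_le_integral => //.
  - by move=> *; exact: poweR_ge0.
  - exact: measurable_poweR_comp.
  apply: filterS (ge0_integral_eq0_ae mW W0 IW) => y Wy _.
  have -> : h y = 0 by apply/eqP; rewrite eq_le h0 -Wy le_rdf.
  by rewrite poweR0r ?gt_eqF.
by move: hq0; rewrite integral_cst// mul0e leNgt hq.
Qed.

(** Weights are real-valued, whereas [rdf] may be infinite on a null set: its [fine] part is taken,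
    and the pointwise properties survive a.e. *)
Lemma rdf_majorant (q : R) (h : En -> R) : (1 < q)%R -> (q <= 2)%R ->
  measurable_fun setT h -> (forall x, (0 <= h x)%R) ->
  0 < \int[leb]_x (h x `^ q)%:E -> \int[leb]_x (h x `^ q)%:E < +oo ->
  exists W : En -> R, [/\ measurable_fun setT W /\ (forall x, (0 <= W x)%R),
    {ae leb, forall x, (h x <= W x)%R}, {ae leb, forall x, (0 < W x)%R},
    A1_bound (rdf_A1 q) W &
    \int[leb]_x (W x `^ q)%:E <= 8%:E * \int[leb]_x (h x `^ q)%:E].
Proof.
move=> q1 q2 mh h0 hq hqoo; have q0 : (0 < q)%R by exact: lt_trans q1.
pose H := EFin \o h.
have mH : measurable_fun setT H by exact/measurable_EFinP.
have H0 x : 0 <= H x by rewrite lee_fin.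
have W0 := rdf_ge0 q1 q2 H0; have mW := measurable_rdf q1 q2 mH H0.
have IW := integral_rdf q1 q2 mH H0.
have Wpos := rdf_gt0 q1 q2 mH H0 hq.
have Wfin : \forall x \ae leb, rdf q H x = (fine (rdf q H x))%:E.
  have : \int[leb]_x (rdf q H x `^ q) < +oo.
    by apply: (le_lt_trans IW); rewrite lte_mul_pinfty ?lee_fin.
  move=> /ge0_integral_lty_ae-/(_ (measurable_poweR_comp q mW) (fun _ => poweR_ge0 _ _)).
  apply: filterS => x /lty_poweRy; rewrite gt_eqF// => /(_ isT) Wx.
  by rewrite fineK// ge0_fin_numE.
pose W x := fine (rdf q H x).
have fW0 x : (0 <= W x)%R by exact: fine_ge0.
have mfW : measurable_fun setT W by exact: (measurableT_comp (fine_measurable measurableT)).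
exists W; split => //.
- by apply: filterS Wfin => x Wx; rewrite -lee_fin /W -Wx; exact: le_rdf.
- by apply: filterS Wfin => x Wx; rewrite -lte_fin /W -Wx.
- move=> a l l0; have := Wfin; apply: filterS => x Wx ax.
  rewrite EFinM /W -Wx; apply: le_trans (average_rdf q1 q2 mH H0 l0 ax).
  apply: average_le_ae => //; first exact/measurable_EFinP.
  by apply: filterS Wfin => y Wy _; rewrite /= -Wy.
- apply: le_trans IW; apply: ae_ge0_le_integral => //.
  + by move=> *; rewrite lee_fin powR_ge0.
  + by apply/measurable_EFinP; exact: measurable_powRl.
  + by move=> *; exact: poweR_ge0.
  + exact: measurable_poweR_comp.
  by apply: filterS Wfin => x Wx _; rewrite Wx poweR_EFin.
Qed.

End rdf_majorant.
Arguments rdf_A1 {R} n q.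

(** * Extrapolation *)

Section operators.
Context {R : realType} {n : nat}.
Local Notation En := 'rV[R]_n.
Local Notation leb := (@lebesgue_rV R n).
Implicit Types (f : En -> R[i]) (w : En -> R) (p L : R).
Implicit Type T : (En -> R[i]) -> (En -> R[i]).

Definition cnorm f (x : En) : R := Normc.normc (f x).

Definition Lp_mass p w f : \bar R := \int[leb]_x (cnorm f x `^ p * w x)%:E.

Lemma cnorm_ge0 f x : (0 <= cnorm f x)%R.
Proof. by rewrite /cnorm; case: (f x) => a b; exact: sqrtr_ge0. Qed.

Lemma measurable_cnorm f : measurable_complex f -> measurable_fun setT (cnorm f).
Proof.
move=> [mr mi].
have -> : cnorm f = fun x => ((complex.Re (f x) ^+ 2 + complex.Im (f x) ^+ 2) `^ 2^-1)%R.
  apply/funext => x; rewrite /cnorm; case: (f x) => a b /=.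
  by rewrite powR12_sqrt// addr_ge0// sqr_ge0.
by apply: measurable_powRl; apply: measurable_funD; exact: measurable_funX.
Qed.

Lemma measurable_Lp_mass p w f : measurable_complex f -> measurable_fun setT w ->
  measurable_fun setT (fun x => (cnorm f x `^ p * w x)%:E).
Proof.
move=> mf mw; apply/measurable_EFinP; apply: measurable_funM => //.
by apply: measurable_powRl; exact: measurable_cnorm.
Qed.

Lemma Lp_mass_ge0 p w f : (forall x, (0 <= w x)%R) -> 0 <= Lp_mass p w f.
Proof.
by move=> w0; apply: integral_ge0 => x _; rewrite lee_fin mulr_ge0// powR_ge0.
Qed.

Lemma Lp_mass_cst1 p f : Lp_mass p (cst 1%R) f = \int[leb]_x (cnorm f x `^ p)%:E.
Proof. by apply: eq_integral => x _; rewrite mulr1. Qed.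

Lemma in_LpE p w f : (0 < p)%R ->
  in_Lp p w f <-> measurable_complex f /\ Lp_mass p w f < +oo.
Proof.
move=> p0; rewrite /in_Lp /Lp_norm -/(Lp_mass p w f).
have pV0 : (p^-1 != 0)%R by rewrite invr_eq0 gt_eqF.
by split => -[mf fp]; split => //; [exact: lty_poweRy fp|exact: poweR_lty].
Qed.

Lemma Lp_norm_le p w f f' L : (0 < p)%R -> (0 <= L)%R ->
  (forall x, (0 <= w x)%R) ->
  (Lp_norm p w f' <= L%:E * Lp_norm p w f) =
  (Lp_mass p w f' <= (L `^ p)%:E * Lp_mass p w f).
Proof.
move=> p0 L0 w0; have pV0 : (0 < p^-1)%R by rewrite invr_gt0.
have I0 := Lp_mass_ge0 p f w0.
have LE : L%:E * Lp_norm p w f = ((L `^ p)%:E * Lp_mass p w f) `^ p^-1.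
  by rewrite poweRM ?lee_fin ?powR_ge0// poweR_EFin -powRrM mulfV ?gt_eqF// powRr1.
have I0' := Lp_mass_ge0 p f' w0.
rewrite LE /Lp_norm -/(Lp_mass p w f'); apply/idP/idP => H.
  have := ge0_le_poweR (ltW p0) (poweR_ge0 _ _) H.
  rewrite -!poweRrM mulVf ?gt_eqF// (poweRe1 I0') poweRe1//.
  by apply: mule_ge0; [rewrite lee_fin powR_ge0|exact: I0].
by apply: ge0_le_poweR => //; exact: ltW.
Qed.

Lemma op_norm_ge0 T p w : 0 <= op_norm T p w.
Proof. by apply: le_ereal_inf_tmp => _ [C [C0 _] <-]; rewrite lee_fin. Qed.

Lemma op_norm_lty_in_Lp T p w f : op_norm T p w < +oo ->
  in_Lp p w f -> in_Lp p w (T f).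
Proof. by move=> /ereal_inf_lt[_ [C [_ CT] _] _] /CT[]. Qed.

Lemma op_norm_mass T p w L f : (0 < p)%R -> (forall x, (0 <= w x)%R) ->
  op_norm T p w <= L%:E -> in_Lp p w f ->
  in_Lp p w (T f) /\ Lp_mass p w (T f) <= (L `^ p)%:E * Lp_mass p w f.
Proof.
move=> p0 w0 TL wf.
have L0 : (0 <= L)%R by rewrite -lee_fin (le_trans (op_norm_ge0 T p w)).
split; first by apply: op_norm_lty_in_Lp wf; rewrite (le_lt_trans TL) ?ltry.
rewrite -Lp_norm_le//.
have : 0 <= Lp_norm p w f by exact: poweR_ge0.
have := wf; rewrite /in_Lp => -[_].
case E : (Lp_norm p w f) => [r| |]// _; rewrite lee_fin => r0.
(* The infimum need not be an admissible constant. One below [L + e / (r + 1)] costs at most [e],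
   and the [+ 1] covers [r = 0]. *)
apply/lee_addgt0Pr => e e0.
have r1 : (0 < r + 1)%R by rewrite ltr_wpDl.
have : op_norm T p w < (L + e / (r + 1))%:E.
  by rewrite (le_lt_trans TL)// lte_fin ltrDl divr_gt0.
move=> /ereal_inf_lt[_ [C [C0 CT] <-]]; rewrite lte_fin => CL.
have [_ /le_trans] := CT f wf; apply.
rewrite E -!EFinM -EFinD lee_fin.
apply: (@le_trans _ _ ((L + e / (r + 1)) * r)%R); first by rewrite ler_wpM2r// ltW.
rewrite mulrDl lerD2l -mulrA ler_piMr ?(ltW e0)//.
by rewrite mulrC ler_pdivrMr// mul1r lerDl.
Qed.

Lemma op_norm_le T p w L : (0 < p)%R -> (0 <= L)%R -> (forall x, (0 <= w x)%R) ->
  (forall f, in_Lp p w f -> in_Lp p w (T f) /\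
     Lp_mass p w (T f) <= (L `^ p)%:E * Lp_mass p w f) ->
  op_norm T p w <= L%:E.
Proof.
move=> p0 L0 w0 H; apply: ereal_inf_lbound; exists L; last by [].
split=> [|f /H[fT fL]]; first exact: L0.
by split; [exact: fT|rewrite (Lp_norm_le _ _ p0 L0 w0)].
Qed.

Section extrapolation.
Variables (T : (En -> R[i]) -> (En -> R[i])) (p p0 L : R).
Hypotheses (p01 : (1 < p0)%R) (L0 : (0 <= L)%R).
Hypothesis Tp : unweighted_norm T p < +oo.

(** Covers the functions that vanish a.e., for which [rdf_majorant] gives no weight. *)
Lemma unweighted_mass_eq0 f : (0 < p)%R -> in_Lp p (cst 1%R) f ->
  Lp_mass p (cst 1%R) f = 0 -> Lp_mass p (cst 1%R) (T f) = 0.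
Proof.
move=> pp pf f0; have p1 (x : En) : (0 <= cst 1 x :> R)%R by exact: ler01.
have TL : op_norm T p (cst 1%R) <= (fine (unweighted_norm T p))%:E.
  by rewrite fineK// ge0_fin_numE//; exact: op_norm_ge0.
have [_] := op_norm_mass pp p1 TL pf.
by rewrite f0 mule0 => H; apply/eqP; rewrite eq_le H Lp_mass_ge0.
Qed.

(** Take [W >= |f|] from [rdf_majorant] and [w = W^(-s)] with [s = p0 - p]. Then
    [|f|^p0 w <= |f|^p], and [|Tf|^p = (|Tf|^p0 w)^t (W^p)^(1-t)] with [t = p / p0], so Hölder turns
    the bound at [p0] into one at [p]. The hypothesis is a uniform bound [L] over a class of
    weights, so that it serves both signs of beta, with [L = 0] in the negative case. *)
Lemma extrapolation_below :
  (1 < p)%R -> (p <= 2)%R -> (p < p0)%R ->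
  (forall w, Ap p0 w -> {ae leb, forall x, (0 < w x)%R} ->
     Ap_const p0 w <= (rdf_A1 n p `^ (p0 - p))%:E -> op_norm T p0 w <= L%:E) ->
  unweighted_norm T p <= (8 * L)%:E.
Proof.
move=> p1 p2 pp0 TL; have pp : (0 < p)%R by exact: lt_trans p1.
have p00 : (0 < p0)%R by exact: lt_trans p01.
have w1 (x : En) : (0 <= cst 1 x :> R)%R by exact: ler01.
apply: (op_norm_le pp _ w1); first by rewrite mulr_ge0.
move=> f pf; split; first exact: op_norm_lty_in_Lp pf.
have [f0|fN0] := eqVneq (Lp_mass p (cst 1%R) f) 0.
  by rewrite unweighted_mass_eq0// mule_ge0 ?Lp_mass_ge0// lee_fin powR_ge0.
have [mf foo] := (in_LpE _ _ pp).1 pf.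
have [mTf _] := (in_LpE _ _ pp).1 (op_norm_lty_in_Lp Tp pf).
have fpos : 0 < Lp_mass p (cst 1%R) f by rewrite lt_neqAle eq_sym fN0 Lp_mass_ge0.
have mcf := measurable_cnorm mf; have mcT := measurable_cnorm mTf.
rewrite !Lp_mass_cst1 in foo fpos *.
have [W [[mW W0] fW Wpos A1 IW]] := rdf_majorant p1 p2 mcf (cnorm_ge0 f) fpos foo.
set I := \int[leb]_x (cnorm f x `^ p)%:E in foo fpos IW *.
have A0 : (0 < rdf_A1 n p)%R.
  rewrite mulr_gt0 ?exprn_gt0// mulr_gt0// (lt_le_trans ltr01)//.
  exact: rdf_cst_ge1.
pose s := (p0 - p)%R; have s0 : (0 < s)%R by rewrite subr_gt0.
have sp : (s < p0 - 1)%R by rewrite /s; lra.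
have [wW cW] := negpow_weight A0 p01 s0 sp mW W0 Wpos A1.
pose w x := (W x `^ (- s))%R; rewrite -/w in wW cW.
have mw : measurable_fun setT w by exact: measurable_powRl.
have w0 x : (0 <= w x)%R by exact: powR_ge0.
have wpos : {ae leb, forall x, (0 < w x)%R}.
  by apply: filterS Wpos => x Wx; exact: powR_gt0.
have fw : Lp_mass p0 w f <= I.
  apply: ae_ge0_le_integral => //.
  - by move=> x _; rewrite lee_fin mulr_ge0// powR_ge0.
  - exact: measurable_Lp_mass.
  - by move=> x _; rewrite lee_fin powR_ge0.
  - by apply/measurable_EFinP; exact: measurable_powRl.
  apply: filterS2 fW Wpos => x hx Wx _; rewrite lee_fin.
  have f0 := cnorm_ge0 f x.
  have [->|cN0] := eqVneq (cnorm f x) 0%R.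
    by rewrite powR0 ?gt_eqF// mul0r powR_ge0.
  rewrite (_ : p0 = (p + s)%R); last by rewrite /s addrC subrK.
  rewrite powRD; last by rewrite cN0 implybT.
  rewrite /w powRN -mulrA ler_piMr ?powR_ge0//.
  rewrite ler_pdivrMr ?powR_gt0// mul1r.
  by apply: ge0_ler_powR; rewrite ?nnegrE ?(ltW s0)// ltW.
have inw : in_Lp p0 w f by apply/in_LpE => //; split => //; exact: le_lt_trans fw foo.
have TLw : op_norm T p0 w <= L%:E.
  by apply: TL => //; split => //; apply: (le_lt_trans cW); rewrite ltry.
have [_ Tfw] := op_norm_mass p00 w0 TLw inw.
pose t := (p / p0)%R.
have t0 : (0 < t)%R by rewrite divr_gt0.
have t1 : (t < 1)%R by rewrite ltr_pdivrMr// mul1r.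
pose F x := (cnorm (T f) x `^ p0 * w x)%R.
pose G x := (W x `^ p)%R.
have F0 x : (0 <= F x)%R by rewrite mulr_ge0// powR_ge0.
have mF : measurable_fun setT F.
  by apply: measurable_funM => //; exact: measurable_powRl.
have mG : measurable_fun setT G by exact: measurable_powRl.
have TfFG : \int[leb]_x (cnorm (T f) x `^ p)%:E =
    \int[leb]_x (F x `^ t * G x `^ (1 - t))%:E.
  apply: ge0_ae_eq_integral => //.
  - by apply/measurable_EFinP; exact: measurable_powRl.
  - apply/measurable_EFinP; apply: measurable_funM; exact: measurable_powRl.
  - by move=> x _; rewrite lee_fin powR_ge0.
  - by move=> x _; rewrite lee_fin mulr_ge0// powR_ge0.
  apply: filterS Wpos => x Wx _; congr EFin.
  rewrite /F /G powRM ?powR_ge0// /w -!powRrM -mulrA -powRD; last first.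
    by rewrite (gt_eqF Wx) implybT.
  have -> : (- s * t + p * (1 - t) = 0)%R.
    by rewrite /s /t; field; rewrite gt_eqF.
  rewrite powRr0 mulr1; congr (_ `^ _)%R; rewrite /t; field; by rewrite gt_eqF.
rewrite TfFG.
apply: (le_trans (hoelder_powR leb measurableT mF mG (fun x _ => F0 x)
  (fun x _ => powR_ge0 _ _) t0 t1)).
have I0 : 0 <= I by exact: ltW.
have t10 : (0 <= 1 - t)%R by rewrite subr_ge0 ltW.
have FI : \int[leb]_x (F x)%:E <= (L `^ p0)%:E * I.
  by apply: (le_trans Tfw); rewrite lee_wpmul2l// lee_fin powR_ge0.
apply: (@le_trans _ _ (((L `^ p0)%:E * I) `^ t * (8%:E * I) `^ (1 - t))).
  apply: lee_pmul; rewrite ?poweR_ge0//.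
    by apply: ge0_le_poweR => //; [exact: ltW|apply: integral_ge0 => x _; rewrite lee_fin].
  apply: (ge0_le_poweR t10 _ IW).
  by apply: integral_ge0 => x _; rewrite lee_fin powR_ge0.
rewrite !poweRM ?lee_fin ?powR_ge0// muleACA.
rewrite -poweRD; last first.
  apply: nneg_neq0_poweRD_def => //; [by rewrite gt_eqF|exact: ltW].
have -> : (t + (1 - t) = 1)%R by ring.
rewrite poweRe1// lee_wpmul2r// !poweR_EFin -EFinM lee_fin -powRrM.
have -> : (p0 * t = p)%R by rewrite /t; field; rewrite gt_eqF.
rewrite powRM// mulrC ler_wpM2r ?powR_ge0//.
by apply: ler_powR; [rewrite ler1n|lra].
Qed.

(** With [W >= |Tf|^(p-p0)], the integral [J] of [|Tf|^p] is at most that of [|Tf|^p0 W], hence at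
    most [L^p0] times that of [|f|^p0 W]. Hölder with [t = p0 / p] bounds the latter by
    [I^t (8 J)^(1-t)], and the power of [J] is absorbed on the left. *)
Lemma extrapolation_above :
  (2 * p0 <= p)%R ->
  (forall w, Ap p0 w -> {ae leb, forall x, (0 < w x)%R} ->
     Ap_const p0 w <= (rdf_A1 n (p / (p - p0)))%:E -> op_norm T p0 w <= L%:E) ->
  unweighted_norm T p <= (8 * L)%:E.
Proof.
move=> pp0 TL; have p00 : (0 < p0)%R by exact: lt_trans p01.
have pp : (0 < p)%R by lra.
have d0 : (0 < p - p0)%R by lra.
pose q := (p / (p - p0))%R; rewrite -/q in TL.
have q1 : (1 < q)%R by rewrite ltr_pdivlMr//; lra.
have q2 : (q <= 2)%R by rewrite ler_pdivrMr//; lra.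
have q0 : (0 < q)%R by exact: lt_trans q1.
have w1 (x : En) : (0 <= cst 1 x :> R)%R by exact: ler01.
apply: (op_norm_le pp _ w1); first by rewrite mulr_ge0.
move=> f pf; have pTf := op_norm_lty_in_Lp Tp pf; split => //.
have [mf foo] := (in_LpE _ _ pp).1 pf.
have [mTf Tfoo] := (in_LpE _ _ pp).1 pTf.
have [J0|JN0] := eqVneq (Lp_mass p (cst 1%R) (T f)) 0.
  by rewrite J0 mule_ge0 ?Lp_mass_ge0// lee_fin powR_ge0.
have Jpos : 0 < Lp_mass p (cst 1%R) (T f) by rewrite lt_neqAle eq_sym JN0 Lp_mass_ge0.
have I0 : 0 <= Lp_mass p (cst 1%R) f by exact: Lp_mass_ge0.
have mcf := measurable_cnorm mf; have mcT := measurable_cnorm mTf.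
rewrite !Lp_mass_cst1 in foo Tfoo Jpos I0 *.
pose g x := (cnorm (T f) x `^ (p - p0))%R.
have mg : measurable_fun setT g by exact: measurable_powRl.
have gq x : (g x `^ q = cnorm (T f) x `^ p)%R.
  by rewrite /g -powRrM /q mulrC divfK// gt_eqF.
have [] := @rdf_majorant _ n q g q1 q2 mg (fun x => powR_ge0 _ _).
- by under eq_integral do rewrite gq.
- by under eq_integral do rewrite gq.
move=> W [[mW W0] gW Wpos A1].
under [X in _ <= _ * X -> _]eq_integral do rewrite gq.
set J := \int[leb]_x (cnorm (T f) x `^ p)%:E in Tfoo Jpos *.
set I := \int[leb]_x (cnorm f x `^ p)%:E in foo I0 *.
move=> IW.
have A0 : (0 < rdf_A1 n q)%R.
  rewrite mulr_gt0 ?exprn_gt0// mulr_gt0// (lt_le_trans ltr01)//.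
  exact: rdf_cst_ge1.
have cW := A1_Ap_const A0 p01 mW W0 A1.
have TLW : op_norm T p0 W <= L%:E.
  apply: TL => //; split; first exact: A1_is_weight A1.
  by apply: (le_lt_trans cW); rewrite ltry.
pose t := (p0 / p)%R.
have t0 : (0 < t)%R by rewrite divr_gt0.
have t1 : (t < 1)%R by rewrite ltr_pdivrMr//; lra.
have t10 : (0 <= 1 - t)%R by rewrite subr_ge0 ltW.
have tp : (p * t = p0)%R by rewrite /t; field; rewrite gt_eqF.
have tq : (q * (1 - t) = 1)%R by rewrite /t /q; field; rewrite !gt_eqF.
pose F x := (cnorm f x `^ p)%R; pose G x := (W x `^ q)%R.
have mF : measurable_fun setT F by exact: measurable_powRl.
have mG : measurable_fun setT G by exact: measurable_powRl.
have fW : Lp_mass p0 W f <= I `^ t * (8%:E * J) `^ (1 - t).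
  rewrite /Lp_mass; under eq_integral => x _.
    rewrite (_ : _ * _ = F x `^ t * G x `^ (1 - t))%R; last first.
      by rewrite /F /G -!powRrM tp tq powRr1.
    over.
  apply: (le_trans (hoelder_powR leb measurableT mF mG (fun x _ => powR_ge0 _ _)
    (fun x _ => powR_ge0 _ _) t0 t1)).
  apply: lee_wpmul2l; first exact: poweR_ge0.
  apply: (ge0_le_poweR t10 _ IW).
  by apply: integral_ge0 => x _; rewrite lee_fin powR_ge0.
have fin8J : 8%:E * J < +oo.
  by apply: lte_mul_pinfty; [rewrite lee_fin|by []|exact: Tfoo].
have inW : in_Lp p0 W f.
  apply/in_LpE => //; split => //; apply: (le_lt_trans fW).
  by rewrite lte_mul_pinfty ?poweR_ge0 ?poweR_lty// ge0_fin_numE ?poweR_ge0// poweR_lty.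
have [_ TfW] := op_norm_mass p00 W0 TLW inW.
have JW : J <= Lp_mass p0 W (T f).
  apply: ae_ge0_le_integral => //.
  - by move=> x _; rewrite lee_fin powR_ge0.
  - by apply/measurable_EFinP; exact: measurable_powRl.
  - by move=> x _; rewrite lee_fin mulr_ge0// powR_ge0.
  - exact: measurable_Lp_mass.
  apply: filterS gW => x gx _; rewrite lee_fin.
  rewrite [in leLHS](_ : p = p0 + (p - p0))%R; last by rewrite addrC subrK.
  rewrite powRD; last by rewrite gt_eqF// addrC subrK.
  by rewrite ler_wpM2l ?powR_ge0.
have {}JW : J <= (L `^ p0)%:E * (I `^ t * (8%:E * J) `^ (1 - t)).
  apply: (le_trans JW); apply: (le_trans TfW).
  by rewrite lee_wpmul2l// lee_fin powR_ge0.
clear -pp p00 d0 t0 t1 t10 tp L0 I0 foo Jpos Tfoo JW p01.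
case: J Jpos Tfoo JW => [j| |]//; rewrite lte_fin => j0 _.
case: I I0 foo => [i| |]//; rewrite lee_fin => i0 _.
rewrite -!EFinM !lee_fin => H.
have jE : (j = j `^ t * j `^ (1 - t))%R.
  rewrite -powRD ?(gt_eqF j0) ?implybT//.
  by rewrite addrCA subrr addr0 powRr1// ltW.
(* Cancelling [j^(1-t)] needs [J] positive and finite; finiteness is the a priori bound [Tp]. *)
have {H} : (j `^ t <= L `^ p0 * i `^ t * 8 `^ (1 - t))%R.
  rewrite -(ler_pM2r (powR_gt0 (1 - t) j0)) -jE (le_trans H)//.
  by rewrite powRM ?(ltW j0)// !mulrA.
have tV0 : (0 <= t^-1)%R by rewrite invr_ge0 ltW.
have r0 : (0 <= L `^ p0 * i `^ t * 8 `^ (1 - t))%R by rewrite !mulr_ge0 ?powR_ge0.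
move=> /(ge0_ler_powR tV0); rewrite !nnegrE powR_ge0 => /(_ isT r0).
rewrite !powRM ?mulr_ge0 ?powR_ge0// -!powRrM mulfV ?gt_eqF// !powRr1 ?(ltW j0)//.
move=> /le_trans; apply.
have -> : (p0 / t = p)%R by rewrite -tp; field; rewrite gt_eqF.
rewrite mulrAC ler_wpM2r// mulrC ler_wpM2r ?powR_ge0//.
apply: ler_powR; first by rewrite ler1n.
by rewrite ler_pdivrMr// tp (le_trans _ (ltW p01))// lerBlDr lerDl ltW.
Qed.

End extrapolation.
End operators.

(** * Bumped weights *)

Section bump.
Context {R : realType} {n : nat}.
Local Notation En := 'rV[R]_n.
Local Notation leb := (@lebesgue_rV R n).
Implicit Types (w : En -> R) (p N : R).

(** Multiplicative, so that the new weight stays between [w] and [(1 + N) w] and remains in A_p. *)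
Definition bump (B : set En) N w (x : En) : R := (w x * (1 + N * \1_B x))%R.

Variables (p : R) (w : En -> R).
Hypotheses (p1 : (1 < p)%R) (wA : Ap p w) (wpos : {ae leb, forall x, (0 < w x)%R}).

Let mw : measurable_fun setT w. Proof. by case: wA => -[]. Qed.
Let w0 x : (0 <= w x)%R. Proof. by case: wA => -[]. Qed.
Let p10 : (0 < p - 1)%R. Proof. by rewrite subr_gt0. Qed.

Lemma bump_ge B N x : (0 <= N)%R -> (w x <= bump B N w x)%R.
Proof.
move=> N0; rewrite /bump ler_peMr// lerDl mulr_ge0// indicE; case: (_ \in _) => //.
Qed.

Lemma bump_ge0 B N x : (0 <= N)%R -> (0 <= bump B N w x)%R.
Proof. by move=> N0; rewrite (le_trans (w0 x))// bump_ge. Qed.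

Lemma bump_le B N x : (0 <= N)%R -> (bump B N w x <= (1 + N) * w x)%R.
Proof.
move=> N0; rewrite /bump mulrC ler_wpM2r// lerD2l indicE; case: (_ \in _).
  by rewrite mulr1.
by rewrite mulr0.
Qed.

Lemma measurable_bump B N : measurable B -> measurable_fun setT (bump B N w).
Proof.
move=> mB; apply: measurable_funM => //; apply: measurable_funD => //.
by apply: measurable_funM => //; exact: measurable_indic.
Qed.

Lemma dual_weight_bump B N x : (0 <= N)%R ->
  dual_weight p (bump B N w) x <= dual_weight p w x.
Proof.
move=> N0; have [wx|wx] := eqVneq (w x) 0%R.
  by rewrite /dual_weight wx eqxx leey.
have wx0 : (0 < w x)%R by rewrite lt_neqAle eq_sym wx w0.
have bx0 : (0 < bump B N w x)%R by rewrite (lt_le_trans wx0)// bump_ge.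
rewrite !dual_weightE// lee_fin !powRN lef_pV2 ?posrE ?powR_gt0//.
apply: ge0_ler_powR; rewrite ?nnegrE ?invr_ge0 ?(ltW p10) ?(ltW wx0) ?(ltW bx0)//.
exact: bump_ge.
Qed.

Lemma le_average (a : En) (l : R) (f g : En -> \bar R) : (0 < l)%R ->
  measurable_fun setT f -> measurable_fun setT g ->
  (forall x, 0 <= f x) -> (forall x, f x <= g x) ->
  average (cube a l) f <= average (cube a l) g.
Proof.
move=> l0 mf mg f0 fg; apply: average_le_ae => //.
  by move=> x; rewrite (le_trans (f0 x)).
by apply: aeW => x _.
Qed.

Lemma Ap_bump B N : measurable B -> (0 <= N)%R -> Ap p (bump B N w).
Proof.
move=> mB N0; have mb := measurable_bump N mB.
have b0 x := bump_ge0 B x N0.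
have N1 : (0 <= 1 + N)%R by rewrite addr_ge0.
have ab a l : (0 < l)%R -> average (cube a l) (EFin \o bump B N w) <=
    (1 + N)%:E * average (cube a l) (EFin \o w).
  move=> l0; rewrite -average_scale//; last exact/measurable_EFinP.
  apply: le_average => //.
  - exact/measurable_EFinP.
  - by apply: measurable_funeM; exact/measurable_EFinP.
  - by move=> x; rewrite /= -EFinM lee_fin bump_le.
have [[_ _ wC] Apoo] := wA.
split.
  split => // C cC; have := wC C cC.
  have I0 : 0 <= \int[leb]_(x in C) (w x)%:E.
    by apply: integral_ge0 => x _; rewrite lee_fin.
  case: wA => -[]; have [M CM] := compact_sub_big_cube cC => _ _ _ _ _.
  apply: le_lt_trans (ge0_integral_subset _ _ CM) _; first by move=> x; rewrite lee_fin.
  have M0 : (0 < 2 * M.+1%:R :> R)%R by rewrite mulr_gt0.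
  have cM : compact (@big_cube R n M.+1).
    exact: compact_cube.
  have aw : average (@big_cube R n M.+1) (EFin \o w) < +oo.
    by rewrite integral_cube_lty//; exact: wC.
  rewrite -integral_cube_lty//.
  by apply: (le_lt_trans (ab _ _ M0)); rewrite lte_mul_pinfty ?lee_fin.
apply: (@le_lt_trans _ _ ((1 + N)%:E * Ap_const p w)); last first.
  by rewrite lte_mul_pinfty ?lee_fin.
apply: Ap_const_le => a l l0.
apply: (@le_trans _ _ ((1 + N)%:E * average (cube a l) (EFin \o w) *
    average (cube a l) (dual_weight p w) `^ (p - 1))).
  apply: lee_pmul (ab _ _ l0) _; [|exact: poweR_ge0|].
    by apply: average_ge0 => x; rewrite /= lee_fin.
  apply: ge0_le_poweR; [exact: ltW|by apply: average_ge0 => x; exact: dual_weight_ge0|].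
  apply: le_average => //; [exact: measurable_dual_weight|exact: measurable_dual_weight| |].
    by move=> x; exact: dual_weight_ge0.
  by move=> x; exact: dual_weight_bump.
rewrite -muleA lee_wpmul2l ?lee_fin//.
by apply: ereal_sup_ubound; exists (a, l).
Qed.

(** Hölder's inequality for [1 = w^(1/p) v^(1-1/p)] with [v = w^(-1/(p-1))]; on a unit cube,
    averages are integrals. *)
Lemma unit_cube_hoelder (a : En) :
  1 <= \int[leb]_(x in cube a 1%R) (w x)%:E *
       (\int[leb]_(x in cube a 1%R) dual_weight p w x) `^ (p - 1).
Proof.
have pp : (0 < p)%R by exact: lt_trans p1.
have I0 : 0 <= \int[leb]_(x in cube a 1%R) (w x)%:E.
  by apply: integral_ge0 => x _; rewrite lee_fin.
pose v x := (w x `^ (- (p - 1)^-1))%R.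
have v0 x : (0 <= v x)%R by exact: powR_ge0.
have mv : measurable_fun setT v by exact: measurable_powRl.
have mC := @measurable_cube R n a 1%R.
have pV0 : (0 < p^-1)%R by rewrite invr_gt0.
have pV1 : (p^-1 < 1)%R by rewrite invf_lt1.
have := hoelder_powR leb mC (measurable_funS measurableT (@subsetT _ _) mw)
  (measurable_funS measurableT (@subsetT _ _) mv) (fun x _ => w0 x)
  (fun x _ => v0 x) pV0 pV1.
rewrite [X in X <= _ -> _](_ : _ = 1); last first.
  rewrite (ge0_ae_eq_integral (g := cst 1)) => [|//| | |//|//|].
  - rewrite integral_cst// mul1e.
    by have := @lebesgue_cube R n a 1%R ler01; rewrite expr1n.
  - apply/measurable_EFinP; apply: measurable_funM; apply: measurable_powRl.
      exact: measurable_funS mw.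
    exact: measurable_funS mv.
  - exact: measurable_cst.
  - by move=> x _; rewrite lee_fin mulr_ge0// powR_ge0.
  apply: filterS wpos => x wx _; congr EFin.
  rewrite /v -powRrM -powRD; last by rewrite (gt_eqF wx) implybT.
  rewrite (_ : _ + _ = 0)%R ?powRr0//; field; rewrite !gt_eqF//.
move=> H.
have : 1 <= ((\int[leb]_(x in cube a 1%R) (w x)%:E) `^ p^-1 *
     (\int[leb]_(x in cube a 1%R) dual_weight p w x) `^ (1 - p^-1)).
  apply: (le_trans H); rewrite lee_wpmul2l ?poweR_ge0//.
  apply: ge0_le_poweR; first by rewrite subr_ge0 ltW.
    by apply: integral_ge0 => x _; rewrite lee_fin.
  apply: ae_ge0_le_integral => //.
  - by move=> x _; rewrite lee_fin.
  - by apply/measurable_EFinP; exact: measurable_funS mv.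
  - by move=> x _; exact: dual_weight_ge0.
  - by apply: measurable_funS (measurable_dual_weight p mw).
  by apply: filterS wpos => x wx _; rewrite dual_weightE.
move=> /(ge0_le_poweR (ltW pp) lee01).
rewrite poweR1r poweRM ?poweR_ge0// -!poweRrM mulVf ?gt_eqF// poweRe1//.
by rewrite mulrBl mul1r mulVf ?gt_eqF.
Qed.

(** [Q] contains two disjoint unit cubes [B] and [B']. Testing the bumped weight with [w] on [B] and
    its dual on [B'] gains the factor [N], but [w] may be much smaller on [B] than on [B'].
    Multiplying by the test of [w] with the roles exchanged pairs each cube with itself, where
    [unit_cube_hoelder] applies. *)
Lemma Ap_const_bump_ge k N : (0 < n)%N -> (0 <= N)%R ->
  (N * ((3 ^+ n)^-1 `^ p) ^+ 2)%:E <=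
  Ap_const p (bump (cube (const_mx k.+1%:R) 1) N w) * Ap_const p w.
Proof.
move=> n0 N0.
pose B : set En := cube (const_mx k.+1%:R) 1%R.
pose B' : set En := cube (const_mx k.+3%:R) 1%R.
pose Q : set En := cube (const_mx k.+1%:R) 3%R.
have kE : (k.+3%:R = k.+1%:R + 2 :> R)%R by rewrite -natrD addn2.
have mB : measurable B by exact: measurable_cube.
have BQ : B `<=` Q by apply: cube_subset => i; rewrite !mxE//; lra.
have B'Q : B' `<=` Q.
  by apply: cube_subset => i; rewrite !mxE kE; lra.
have BB' x : B' x -> x \notin B.
  move=> B'x; rewrite notin_setE => Bx.
  have /andP[_] := Bx (Ordinal n0); have /andP[] := B'x (Ordinal n0).
  by rewrite !mxE kE => h1 h2; have := le_trans h1 h2; lra.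
pose w' := bump B N w; rewrite -/B -/w'.
have mw' : measurable_fun setT w' by exact: measurable_bump.
have w'0 x : (0 <= w' x)%R by exact: bump_ge0.
set X := \int[leb]_(x in B) (w x)%:E; set X' := \int[leb]_(x in B') (w x)%:E.
set Y := \int[leb]_(x in B) dual_weight p w x.
set Y' := \int[leb]_(x in B') dual_weight p w x.
have XY : 1 <= X * Y `^ (p - 1) := unit_cube_hoelder _.
have XY' : 1 <= X' * Y' `^ (p - 1) := unit_cube_hoelder _.
have X0 : 0 <= X by apply: integral_ge0 => x _; rewrite lee_fin.
have X0' : 0 <= X' by apply: integral_ge0 => x _; rewrite lee_fin.
have Y0 : 0 <= Y by apply: integral_ge0 => x _; exact: dual_weight_ge0.
have Y0' : 0 <= Y' by apply: integral_ge0 => x _; exact: dual_weight_ge0.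
set c := ((3 ^+ n)^-1)%R; have c0 : (0 < c)%R by rewrite invr_gt0 exprn_gt0.
(* [c] is the inverse measure of [Q]; it enters once through the first average and to the power
   [p - 1] through the second. *)
have cp : (c `^ p)%:E = c%:E * (c `^ (p - 1))%:E.
  rewrite -EFinM -[X in (_ = (X * _)%:E)]powRr1 ?(ltW c0)// -powRD.
    by rewrite addrC subrK.
  by rewrite (gt_eqF c0) implybT.
have l3 : (0 < 3 :> R)%R by [].
have ub (v : En -> R) : average Q (EFin \o v) * average Q (dual_weight p v) `^ (p - 1)
    <= Ap_const p v.
  by apply: ereal_sup_ubound; exists (const_mx k.+1%:R, 3%R).
have avg (v : En -> R) (Z Z' : \bar R) : 0 <= Z -> 0 <= Z' ->
    Z <= \int[leb]_(x in Q) (v x)%:E ->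
    Z' <= \int[leb]_(x in Q) dual_weight p v x ->
    (c `^ p)%:E * (Z * Z' `^ (p - 1)) <= Ap_const p v.
  move=> Z0 Z0' Zv Z'v; apply: le_trans (ub v).
  rewrite /Q !averageE// -/c -/Q.
  have I0 : 0 <= \int[leb]_(x in Q) dual_weight p v x.
    by apply: integral_ge0 => x _; exact: dual_weight_ge0.
  have c0' : 0 <= c%:E by rewrite lee_fin ltW.
  rewrite (poweRM _ c0' I0) cp muleACA poweR_EFin; apply: lee_pmul.
  - by rewrite mule_ge0// lee_fin ltW.
  - by rewrite mule_ge0 ?poweR_ge0// lee_fin powR_ge0.
  - by rewrite lee_wpmul2l// lee_fin ltW.
  - by rewrite lee_wpmul2l ?lee_fin ?powR_ge0//; apply: ge0_le_poweR => //; exact: ltW.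
have A1 : (c `^ p)%:E * (N%:E * X * Y' `^ (p - 1)) <= Ap_const p w'.
  apply: (avg _ _ _ _ Y0'); first by apply: mule_ge0; [rewrite lee_fin|exact: X0].
    apply: (@le_trans _ _ (\int[leb]_(x in B) (w' x)%:E)).
      rewrite -ge0_integralZl//; last 2 first.
      - by apply/measurable_EFinP; exact: measurable_funS mw.
      - by move=> x _; rewrite lee_fin.
      apply: ge0_le_integral => //.
      - by move=> x _; rewrite mule_ge0 ?lee_fin.
      - by apply: measurable_funeM; apply/measurable_EFinP; exact: measurable_funS mw.
      - by apply/measurable_EFinP; exact: measurable_funS mw'.
      move=> x Bx; rewrite -EFinM lee_fin /w' /bump indicE mem_set// mulr1 mulrC.
      by rewrite ler_wpM2l// lerDr.
    by apply: ge0_integral_subset BQ => x; rewrite lee_fin.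
  apply: (@le_trans _ _ (\int[leb]_(x in B') dual_weight p w' x)).
    rewrite le_eqVlt; apply/orP; left; apply/eqP; apply: eq_integral => x.
    rewrite inE => /BB' xB; rewrite /dual_weight /w' /bump indicE (negbTE xB).
    by rewrite mulr0 addr0 mulr1.
  by apply: ge0_integral_subset B'Q => x; exact: dual_weight_ge0.
have A2 : (c `^ p)%:E * (X' * Y `^ (p - 1)) <= Ap_const p w.
  apply: avg => //.
    by apply: ge0_integral_subset B'Q => x; rewrite lee_fin.
  by apply: ge0_integral_subset BQ => x; exact: dual_weight_ge0.
have C0 : 0 <= (c `^ p)%:E by rewrite lee_fin powR_ge0.
apply: le_trans (lee_pmul _ _ A1 A2); last 2 first.
- by rewrite !mule_ge0 ?poweR_ge0.
- by rewrite !mule_ge0 ?poweR_ge0.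
rewrite muleACA expr2 EFinM muleC EFinM; apply: lee_pmul => //.
- by rewrite mule_ge0.
have assoc (u x y x' y' : \bar R) : u * x * y' * (x' * y) = u * (x * y * (x' * y')).
  by rewrite -!muleA; congr (_ * (_ * _)); rewrite muleCA [in RHS]muleCA [y' * _]muleC.
rewrite assoc -[leLHS]mule1; apply: lee_wpmul2l; first by rewrite lee_fin.
by rewrite -[leLHS]mule1; apply: lee_pmul XY XY'.
Qed.

End bump.

(** * Endpoint orders *)

Section negative_exponent.
Context {R : realType} {n : nat}.
Local Notation En := 'rV[R]_n.
Local Notation leb := (@lebesgue_rV R n).

Lemma Ap_const_ge0 (p : R) (w : En -> R) : (forall x, (0 <= w x)%R) ->
  0 <= Ap_const p w.
Proof.
move=> w0; apply: le_trans (ereal_sup_ubound _); last first.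
  by exists (0%R, 1%R); [exact: ltr01|].
by rewrite mule_ge0 ?poweR_ge0//; apply: average_ge0 => x; rewrite lee_fin.
Qed.

(** The unit cube with corner coordinates [k + 1] is disjoint from [big_cube k]. If all these cubes
    carried more than [e], every [big_cube k] would miss mass [e], against monotone convergence. *)
Lemma far_cube_small (F : En -> \bar R) (e : R) : (0 < n)%N ->
  measurable_fun setT F -> (forall x, 0 <= F x) -> \int[leb]_x F x < +oo ->
  (0 < e)%R -> exists k : nat,
    \int[leb]_(x in cube (const_mx k.+1%:R) 1%R) F x <= e%:E.
Proof.
move=> n0 mF F0 Foo e0; apply: contrapT => /forallNP nk.
have If : \int[leb]_x F x \is a fin_num by rewrite ge0_fin_numE// integral_ge0.
have bound k : \int[leb]_(x in big_cube k) F x <= \int[leb]_x F x - e%:E.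
  rewrite leeBrDr//.
  pose B : set En := cube (const_mx k.+1%:R) 1%R.
  have mB : measurable B by exact: measurable_cube.
  have mK : measurable (@big_cube R n k) by exact: measurable_cube.
  have mFA (A : set En) : measurable_fun A F by exact: measurable_funS mF.
  have eB : e%:E <= \int[leb]_(x in B) F x.
    by move/negP: (nk k); rewrite -ltNge => /ltW.
  apply: le_trans (leeD (lexx _) eB) _.
  rewrite -ge0_integral_setU//; last first.
    apply/disj_set2P/seteqP; split => // x [/big_cubeP kx Bx].
    have /andP[] := Bx (Ordinal n0); rewrite mxE => h _.
    have := le_trans h (le_trans (ler_norm _) (kx (Ordinal n0))).
    by rewrite ler_nat ltnn.
  exact: (@ge0_integral_subset _ _ _ leb _ setT F).
have := @ge0_nondecreasing_set_cvg_integral _ _ _ _ F leb big_cube_ndecr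
  (fun M => measurable_cube _ _) (fun M => measurable_funS measurableT (@subsetT _ _) mF)
  (fun _ x _ => F0 x).
rewrite bigcup_big_cube => cv.
have : \int[leb]_x F x <= \int[leb]_x F x - e%:E.
  exact: cvge_le (nearW _ bound) cv.
by rewrite leeBrDr// -[leRHS]adde0 leeD2lE// lee_fin leNgt e0.
Qed.

(* A bump of height N on a cube carrying little of the mass of f does not
   change the norm of f much, but makes the A_p constant at least of order N. *)
Lemma negative_exponent_norm0 (T : (En -> R[i]) -> (En -> R[i])) (p c beta : R) :
  (0 < n)%N -> (1 < p)%R -> (beta < 0)%R ->
  (forall w, Ap p w -> op_norm T p w <= c%:E * Ap_const p w `^ beta) ->
  forall w, Ap p w -> {ae leb, forall x, (0 < w x)%R} -> op_norm T p w <= 0.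
Proof.
move=> n0 p1 beta0 HT w wA wpos.
have pp : (0 < p)%R by exact: lt_trans p1.
have [[mw w0 _] Apoo] := wA.
have Ap0 := Ap_const_ge0 p w0.
have Apf : Ap_const p w \is a fin_num by rewrite ge0_fin_numE.
apply: (op_norm_le pp (lexx 0%R) w0) => f wf.
have wTf : in_Lp p w (T f).
  apply: op_norm_lty_in_Lp wf; apply: le_lt_trans (HT w wA) _.
  by rewrite -(fineK Apf) poweR_EFin -EFinM ltry.
split => //.
rewrite powR0 ?gt_eqF// mul0e; apply/lee_addgt0Pr => eta eta0; rewrite add0e.
have [mf foo] := (in_LpE _ _ pp).1 wf; have [mTf _] := (in_LpE _ _ pp).1 wTf.
have If : Lp_mass p w f \is a fin_num by rewrite ge0_fin_numE// Lp_mass_ge0.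
set I := fine (Lp_mass p w f).
have I0 : (0 <= I)%R by rewrite fine_ge0// Lp_mass_ge0.
have I1 : (0 < I + 1)%R by rewrite ltr_wpDl.
set A := (fine (Ap_const p w) + 1)%R.
have A0 : (0 < A)%R by rewrite ltr_wpDl// fine_ge0.
(* The constants are chosen backwards: [delta^p (I + 1) = eta], [(|c| + 1) b0^beta = delta] and
   [N kappa = A b0]. As beta is negative, an A_p constant of at least [b0] forces an operator norm
   of at most [delta]. *)
pose delta := ((eta / (I + 1)) `^ p^-1)%R.
have delta0 : (0 < delta)%R by rewrite powR_gt0 ?divr_gt0.
pose kappa := (((3 ^+ n)^-1 `^ p) ^+ 2 : R)%R.
have kappa0 : (0 < kappa)%R by rewrite exprn_gt0// powR_gt0// invr_gt0 exprn_gt0.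
have c1 : (0 < `|c| + 1)%R by rewrite ltr_wpDl.
pose b0 := ((delta / (`|c| + 1)) `^ beta^-1)%R.
have b00 : (0 < b0)%R by rewrite powR_gt0 ?divr_gt0.
pose N := (A / kappa * b0)%R.
have N0 : (0 < N)%R by rewrite mulr_gt0 ?divr_gt0.
pose F x := (cnorm f x `^ p * w x)%:E.
have mF : measurable_fun setT F by exact: measurable_Lp_mass.
have F0 x : 0 <= F x by rewrite lee_fin mulr_ge0// powR_ge0.
have NV0 : (0 < N^-1)%R by rewrite invr_gt0.
(* The height [N] is fixed before the position: on a cube of mass at most [1 / N] the bump adds at
   most 1 to the mass of [f]. *)
have [k kF] := far_cube_small n0 mF F0 foo NV0.
set B : set En := cube _ _ in kF.
pose w' := bump B N w.
have mB : measurable B by exact: measurable_cube.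
have w'A : Ap p w' := Ap_bump p1 wA mB (ltW N0).
have [[mw' w'0 _] Ap'oo] := w'A.
have Apf' : Ap_const p w' \is a fin_num.
  by rewrite (ge0_fin_numE (Ap_const_ge0 p w'0)); exact: Ap'oo.
have fw' : Lp_mass p w' f <= (I + 1)%:E.
  rewrite EFinD /I fineK//.
  have -> : Lp_mass p w' f = \int[leb]_x (F x + N%:E * (F \_ B) x).
    apply: eq_integral => x _; rewrite /w' /bump patchE indicE.
    case: ifPn => _; last by rewrite mulr0 addr0 mulr1 mule0 adde0.
    by rewrite mulr1 -EFinM -EFinD; congr EFin; ring.
  have FB0 x : 0 <= (F \_ B) x by exact: erestrict_ge0.
  have mFB : measurable_fun setT (F \_ B).
    by apply/(measurable_restrictT _ mB); exact: measurable_funS mF.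
  rewrite ge0_integralD//; last 2 first.
  - by move=> x _; rewrite mule_ge0// lee_fin ltW.
  - exact: measurable_funeM.
  rewrite leeD// ge0_integralZl// ?lee_fin ?(ltW N0)// -integral_mkcond.
  by rewrite -lee_pdivlMl// mule1.
have inw' : in_Lp p w' f.
  by apply/in_LpE => //; split => //; rewrite (le_lt_trans fw')// ltry.
have bb0 : (b0 <= fine (Ap_const p w'))%R.
  have := Ap_const_bump_ge p1 wA wpos k n0 (ltW N0).
  rewrite -/B -/w' -/kappa -{1}(fineK Apf') -{1}(fineK Apf) -EFinM lee_fin => h.
  have {}h : (N * kappa <= fine (Ap_const p w') * A)%R.
    by apply: (le_trans h); rewrite ler_wpM2l ?fine_ge0 ?Ap_const_ge0// lerDl.
  rewrite -(ler_pM2r A0) (le_trans _ h)// /N mulrAC divfK ?gt_eqF//.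
  by rewrite mulrC.
have TL : op_norm T p w' <= delta%:E.
  apply: (le_trans (HT w' w'A)).
  rewrite -(fineK Apf') poweR_EFin -EFinM lee_fin.
  set b := fine _ in bb0 *; have bp : (0 < b)%R by exact: lt_le_trans bb0.
  have bd : (b `^ beta <= delta / (`|c| + 1))%R.
    have -> : (delta / (`|c| + 1) = b0 `^ beta)%R.
      by rewrite /b0 -powRrM mulVf ?lt_eqF// powRr1// divr_ge0// ltW.
    rewrite -[beta]opprK !(powRN _ (- beta)) lef_pV2 ?posrE ?powR_gt0 ?divr_gt0//.
    by apply: ge0_ler_powR; rewrite ?nnegrE ?oppr_ge0 ?(ltW beta0) ?(ltW b00) ?(ltW bp).
  apply: (@le_trans _ _ (`|c| * b `^ beta)%R).
    by rewrite ler_wpM2r ?powR_ge0// ler_norm.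
  apply: (@le_trans _ _ ((`|c| + 1) * b `^ beta)%R).
    by rewrite ler_wpM2r ?powR_ge0// lerDl.
  by rewrite mulrC -ler_pdivlMr.
have [_ H] := op_norm_mass pp w'0 TL inw'.
apply: (@le_trans _ _ (Lp_mass p w' (T f))).
  apply: ge0_le_integral => //.
  - by move=> x _; rewrite lee_fin mulr_ge0// powR_ge0.
  - exact: measurable_Lp_mass.
  - exact: measurable_Lp_mass.
  by move=> x _; rewrite lee_fin ler_wpM2l ?powR_ge0// (bump_ge wA)// ltW.
apply: (le_trans H).
apply: (@le_trans _ _ ((delta `^ p)%:E * (I + 1)%:E)).
  by rewrite lee_wpmul2l// lee_fin powR_ge0.
rewrite -EFinM lee_fin /delta -powRrM mulVf ?gt_eqF// powRr1 ?divr_ge0 ?(ltW eta0) ?(ltW I1)//.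
by rewrite divfK// gt_eqF.
Qed.

End negative_exponent.

(** * From growth bounds to orders *)

Section endpoint_orders.
Context {R : realType} {n : nat}.
Local Notation En := 'rV[R]_n.
Implicit Type T : (En -> R[i]) -> (En -> R[i]).

Lemma limf_esup_neqy (U : nbhsType) (f : U -> \bar R) (F : set_system U) (V : set U)
    (M : R) : F V -> (forall x, V x -> f x <= M%:E) -> limf_esup f F != +oo.
Proof.
move=> FV fM; rewrite lt_eqF// (@le_lt_trans _ _ M%:E) ?ltry//.
apply: le_trans (ereal_inf_lbound _) _; first by exists V.
by apply: ge_ereal_sup => _ [x Vx <-]; exact: fM.
Qed.

(** An admissible [a > b] could be tested with [e = a - b], where the exponent is exactly [b] and
    the upper limit is finite. For negative [b] this excludes every [a >= 0]. *)
Lemma endpoint_order_1_le T (b d M : R) : (0 < d)%R ->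
  (forall p, (1 < p)%R -> (p < 1 + d)%R ->
     ((p - 1) `^ b)%:E * unweighted_norm T p <= M%:E) ->
  endpoint_order_1 T <= b%:E.
Proof.
move=> d0 H; apply: ge_ereal_sup => _ [a [a0 aP] <-].
rewrite lee_fin leNgt; apply/negP => ba.
have e0 : (0 < a - b)%R by rewrite subr_gt0.
have := aP _ e0; apply/eqP.
apply: (@limf_esup_neqy _ _ _ [set p | 1 < p /\ p < 1 + d]%R M).
  apply: filterI; first exact: nbhs_right_gt.
  by apply: nbhs_right_lt; rewrite ltrDl.
move=> p /= [p1 pd].
by rewrite (_ : a - (a - b) = b)%R; [exact: H|ring].
Qed.

Lemma endpoint_order_oo_le T (b P M : R) :
  (forall p, (P <= p)%R ->
     unweighted_norm T p * ((p `^ b)^-1)%:E <= M%:E) ->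
  endpoint_order_oo T <= b%:E.
Proof.
move=> H; apply: ge_ereal_sup => _ [g [g0 gP] <-].
rewrite lee_fin leNgt; apply/negP => bg.
have e0 : (0 < g - b)%R by rewrite subr_gt0.
have := gP _ e0; apply/eqP.
apply: (@limf_esup_neqy _ _ _ [set p | P <= p]%R M).
  by apply: nbhs_pinfty_ge; rewrite num_real.
move=> p /= Pp.
by rewrite (_ : g - (g - b) = b)%R; [exact: H|ring].
Qed.

Section bounds.
Variables (T : (En -> R[i]) -> (En -> R[i])) (beta p0 C : R).
Hypotheses (p01 : (1 < p0)%R) (C0 : (0 <= C)%R) (beta0 : (0 <= beta)%R).
Hypothesis T_bounded : forall p : R, (1 < p)%R -> unweighted_norm T p < +oo.
(** Monotone form of the weighted bound, adapted to upper bounds of A_p0 constants; deriving it uses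
    [0 <= beta]. *)
Hypothesis HT : forall w (D : R), Ap p0 w -> (0 <= D)%R -> Ap_const p0 w <= D%:E ->
  op_norm T p0 w <= (C * D `^ beta)%:E.

Let K : R := (2 ^+ n * (4 * (3 ^+ n * 64)))%R.

Let K1 : (1 <= K)%R.
Proof.
rewrite /K; have : (1 <= 2 ^+ n :> R)%R by rewrite exprn_ege1// ler1n.
have : (1 <= 3 ^+ n :> R)%R by rewrite exprn_ege1// ler1n.
move: (2 ^+ n)%R (3 ^+ n)%R => x y hy hx; nra.
Qed.

Let K0 : (0 <= K)%R. Proof. exact: le_trans K1. Qed.

Let rdf_A1E q : rdf_A1 n q = (K / (q - 1))%R.
Proof. by rewrite /rdf_A1 /rdf_cst /K !mulrA. Qed.

(** The extrapolated bound carries [(p-1)^(-beta (p0-p))]. The exponent falls short of [beta (p0-1)]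
    by [beta (p-1)], and the remaining factor [(p-1)^(beta (p-1))] is at most 1. *)
Lemma norm_near1 (p : R) : (1 < p)%R -> (p <= 2)%R -> (p < p0)%R ->
  ((p - 1) `^ (beta * (p0 - 1)))%:E * unweighted_norm T p <=
  (8 * (C * K `^ (p0 * beta)))%:E.
Proof.
move=> p1 p2 pp0; have p10 : (0 < p - 1)%R by rewrite subr_gt0.
set D := (rdf_A1 n p `^ (p0 - p))%R; have D0 : (0 <= D)%R by exact: powR_ge0.
have CD0 : (0 <= C * D `^ beta)%R by rewrite mulr_ge0// powR_ge0.
have := extrapolation_below p01 CD0 (T_bounded p1) p1 p2 pp0
  (fun w wA _ wD => HT wA D0 wD).
have e0 : 0 <= ((p - 1) `^ (beta * (p0 - 1)))%:E by rewrite lee_fin powR_ge0.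
move=> /(lee_wpmul2l e0) /le_trans; apply.
rewrite -EFinM lee_fin mulrCA ler_wpM2l// mulrCA ler_wpM2l//.
rewrite /D rdf_A1E -powRrM powRM ?invr_ge0 ?(ltW p10)//.
rewrite -[X in (_ * (_ * X `^ _))%R]powR_inv1 ?(ltW p10)// -powRrM mulrCA -powRD; last first.
  by rewrite (gt_eqF p10) implybT.
rewrite -[leRHS]mulr1; apply: ler_pM; rewrite ?powR_ge0//.
  by apply: ler_powR => //; rewrite ler_wpM2r//; lra.
have -> : (beta * (p0 - 1) + -1 * ((p0 - p) * beta) = beta * (p - 1))%R by ring.
rewrite [leRHS](_ : 1 = 1 `^ (beta * (p - 1)))%R; last by rewrite powR1.
apply: ge0_ler_powR.
- by rewrite mulr_ge0// ltW.
- by rewrite nnegrE ltW.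
- by rewrite nnegrE.
lra.
Qed.

(** Here [q - 1 = p0 / (p - p0)], so the A_1 constant is [K (p - p0) / p0], at most [K p]. *)
Lemma norm_nearoo (p : R) : (2 * p0 <= p)%R ->
  unweighted_norm T p * ((p `^ beta)^-1)%:E <= (8 * (C * K `^ beta))%:E.
Proof.
move=> pp0; have p00 : (1 < p0)%R by exact: p01.
have pp : (0 < p)%R by lra.
have p1 : (1 < p)%R by lra.
have d0 : (0 < p - p0)%R by lra.
have q1 : (0 <= p / (p - p0) - 1)%R.
  by rewrite subr_ge0 ler_pdivlMr// mul1r; lra.
set D := (rdf_A1 n (p / (p - p0)))%R.
have D0 : (0 <= D)%R by rewrite /D rdf_A1E divr_ge0.
have CD0 : (0 <= C * D `^ beta)%R by rewrite mulr_ge0// powR_ge0.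
have := extrapolation_above p01 CD0 (T_bounded p1) pp0
  (fun w wA _ wD => HT wA D0 wD).
have pb0 : (0 < p `^ beta)%R by exact: powR_gt0.
rewrite lee_pdivrMr// -EFinM => /le_trans; apply.
rewrite lee_fin -!mulrA ler_wpM2l// ler_wpM2l// -powRM ?(ltW pp)//.
apply: ge0_ler_powR; rewrite ?nnegrE ?(mulr_ge0 K0 (ltW pp))//.
rewrite /D rdf_A1E ler_wpM2l//.
have -> : (p / (p - p0) - 1 = p0 / (p - p0))%R by field; rewrite gt_eqF.
rewrite invf_div ler_pdivrMr; [nra|lra].
Qed.

End bounds.
End endpoint_orders.

Theorem theorem1p2 (R : realType) (n : nat) (n_gt0 : (0 < n)%N)
    (T : ('rV[R]_n -> R[i]) -> ('rV[R]_n -> R[i]))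
    (T_bounded : forall p : R, (1 < p)%R -> unweighted_norm T p < +oo)
    (beta p0 : R) (p0_gt1 : (1 < p0)%R)
    (T_weighted : exists c : R, forall w : 'rV[R]_n -> R, Ap p0 w ->
       op_norm T p0 w <= c%:E * Ap_const p0 w `^ beta) :
  maxe (endpoint_order_oo T) (endpoint_order_1 T * ((p0 - 1)^-1)%:E)
    <= beta%:E.
Proof.
have [c HT] := T_weighted; have p00 : (0 < p0 - 1)%R by rewrite subr_gt0.
rewrite ge_max lee_pdivrMr// -EFinM.
have pd p : (p < 1 + Num.min 1 (p0 - 1))%R -> (p <= 2 /\ p < p0)%R.
  by rewrite -ltrBlDl lt_min => /andP[? ?]; split; lra.
have d0 : (0 < Num.min 1 (p0 - 1) :> R)%R by rewrite lt_min ltr01.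
have [beta0|beta0] := leP 0%R beta.
  have HD w D : Ap p0 w -> (0 <= D)%R -> Ap_const p0 w <= D%:E ->
      op_norm T p0 w <= (`|c| * D `^ beta)%:E.
    move=> wA D0 wD; have [[_ w0 _] _] := wA.
    (* [c] may be negative, so it is replaced by its absolute value before the power is enlarged. *)
    apply: (le_trans (HT w wA)); rewrite EFinM.
    apply: (@le_trans _ _ (`|c|%:E * Ap_const p0 w `^ beta)).
      by rewrite lee_wpmul2r ?poweR_ge0// lee_fin ler_norm.
    rewrite lee_wpmul2l ?lee_fin// -poweR_EFin.
    by apply: ge0_le_poweR => //; exact: Ap_const_ge0.
  apply/andP; split.
    by apply: endpoint_order_oo_le => p; exact: norm_nearoo HD p.
  apply: (endpoint_order_1_le d0) => p p1 /pd[p2 pp0].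
  exact: norm_near1 HD p p1 p2 pp0.
have H0 := negative_exponent_norm0 n_gt0 p0_gt1 beta0 HT.
(* The extrapolations are used with [L = 0], since by [H0] the weighted norms vanish for all a.e.
   positive weights, whatever their constant. *)
have norm0 p : (1 < p)%R -> unweighted_norm T p <= (8 * 0)%:E ->
    unweighted_norm T p = 0.
  by rewrite mulr0 => p1 h; apply/eqP; rewrite eq_le h op_norm_ge0.
apply/andP; split.
  apply: (@endpoint_order_oo_le _ _ _ _ (2 * p0)%R 0%R) => p pp0.
  rewrite norm0 ?mul0e//; first by lra.
  apply: (extrapolation_above p0_gt1 _ _ pp0) => //; first by apply: T_bounded; lra.
  by move=> w wA wpos _; exact: H0.
apply: (@endpoint_order_1_le _ _ _ _ _ 0%R d0) => p p1 /pd[p2 pp0].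
rewrite norm0 ?mule0//.
apply: (extrapolation_below p0_gt1 _ _ p1 p2 pp0) => //; first exact: T_bounded.
by move=> w wA wpos _; exact: H0.
Qed.
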